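(* Let $n\geq 1$, $\underline{k}=(k_1,\ldots,k_n),\ \underline{m}=(m_1,\ldots,m_n)\in\mathbb{N}^n$, and let $\mathcal{F}\subseteq 2^{[n]}$ be an intersection-closed family with $|\mathcal{F}|\geq 2$. Let $i\in\{1,\ldots,n\}$ be such that $k_i\geq 5$ and $1\leq m_i\leq\sqrt{k_i}$. If \[0<k_i\,\mathbb{P}\big[\boldsymbol{X}_i=0\big]<\tfrac{1}{2},\] then \[H\big(\boldsymbol{X}_i\boldsymbol{Y}_i\,\big|\,\boldsymbol{X}_{<i},\boldsymbol{Y}_{<i}\big)>H\big(\boldsymbol{X}_i\,\big|\,\boldsymbol{X}_{<i}\big).\]
   Context: $\mathbb{N}$ denotes the positive integers, $[n]=\{1,\ldots,n\}$; a family of sets is intersection-closed if it contains $A\cap B$ whenever it contains $A$ and $B$. Subsets of $[n]$ are identified with their indicator vectors in $\{0,1\}^n$. Given $\underline{k},\underline{m}\in\mathbb{N}^n$, let \[R:=\mathbb{Z}[\varepsilon_1,\ldots,\varepsilon_n,\zeta_1,\ldots,\zeta_n]/\langle \varepsilon_\ell^{k_\ell},\ \zeta_\ell^{m_\ell}-1,\ \varepsilon_\ell(\zeta_\ell-1)\ :\ 1\le \ell\le n\rangle,\] so that $\varepsilon_\ell^{j}\zeta_\ell^{s}=\varepsilon_\ell^j$ for $j\geq1$, $s\geq 0$, and $\varepsilon_\ell^{k_\ell}=0$. Let $S_\ell:=\{0,1,\varepsilon_\ell,\ldots,\varepsilon_\ell^{k_\ell-1},\zeta_\ell,\ldots,\zeta_\ell^{m_\ell-1}\}\subset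 R$, i.e. $S_\ell=\{\varepsilon_\ell^j:1\le j\le k_\ell\}\cup\{\zeta_\ell^s:0\le s\le m_\ell-1\}$, which has $k_\ell+m_\ell$ elements and is closed under multiplication. Let $\Theta:R^n\to\mathbb{Z}^n$ be the product of $n$ copies of the ring homomorphism $R\to\mathbb{Z}$ sending every $\varepsilon_\ell$ to $0$ and every $\zeta_\ell$ to $1$. Define \[\boldsymbol{\mathcal{F}}_{\underline{k},\underline{m}}:=\Big\{z\in\prod_{\ell=1}^n S_\ell:\ \Theta(z)\in\mathcal{F}\Big\}.\] Let $(\boldsymbol{X}_1,\ldots,\boldsymbol{X}_n)$ be uniformly distributed on $\boldsymbol{\mathcal{F}}_{\underline{k},\underline{m}}$ and let $(\boldsymbol{Y}_1,\ldots,\boldsymbol{Y}_n)$ be an independent copy of it. Write $\boldsymbol{X}_{<i}:=(\boldsymbol{X}_1,\ldots,\boldsymbol{X}_{i-1})$ and $\boldsymbol{Y}_{<i}:=(\boldsymbol{Y}_1,\ldots,\boldsymbol{Y}_{i-1})$. The product $\boldsymbol{X}_i\boldsymbol{Y}_i$ is taken in $R$. $H(\cdot|\cdot)$ is conditional Shannon entropy, with natural logarithm. *)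

(* Defs.v *)
From HB Require Import structures.
From mathcomp Require Import all_boot all_order all_algebra.
From mathcomp Require Import finmap all_classical all_reals all_analysis.
From mathcomp Require Import ring.
(* The notations of multinomials clash with those of mathcomp-analysis. *)
From mathcomp Require Import -(notations) mpoly.

Set Implicit Arguments.
Unset Strict Implicit.
Unset Printing Implicit Defensive.

Import Order.TTheory GRing.Theory Num.Theory.

Local Open Scope classical_set_scope.
Local Open Scope ring_scope.

Definition posnat := {k : nat | (0 < k)%N}.
Definition nat_of_posnat (k : posnat) : nat := val k.
Coercion nat_of_posnat : posnat >-> nat.

Section Ring.
Variables (n : nat) (k m : 'I_n -> posnat).

(* Z[eps_1, ..., eps_n, zeta_1, ..., zeta_n]: among the n + n variables the
   first n are the eps_l, the last n the zeta_l. *)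
Definition pring := mpoly (n + n) int.
HB.instance Definition _ := GRing.ComNzRing.on pring.
Definition peps (l : 'I_n) : pring := mpolyX int (mnm1 (lshift n l)).
Definition pzeta (l : 'I_n) : pring := mpolyX int (mnm1 (rshift n l)).

Definition relset : pred pring := fun p =>
  `[< exists a b c : 'I_n -> pring,
        p = \sum_(l < n) (a l * peps l ^+ k l
                          + b l * (pzeta l ^+ m l - 1)
                          + c l * (peps l * (pzeta l - 1))) >].

Definition point01 (j : 'I_(n + n)) : int :=
  if fintype.split j is inl _ then 0 else 1.
Definition aug : pring -> int := meval point01.
HB.instance Definition _ := GRing.RMorphism.on aug.

Lemma aug_eps l : aug (peps l) = 0.
Proof.
by rewrite /aug /peps mevalXU /point01 -[lshift n l]/(unsplit (inl l)) unsplitK.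
Qed.

Lemma aug_zeta l : aug (pzeta l) = 1.
Proof.
by rewrite /aug /pzeta mevalXU /point01 -[rshift n l]/(unsplit (inr l)) unsplitK.
Qed.

Lemma aug_relset p : p \in relset -> aug p = 0.
Proof.
move=> /asboolP[a [b [c ->]]]; rewrite rmorph_sum big1// => l _.
rewrite !rmorphD !rmorphM !rmorphB !rmorphXn/= !rmorph1 aug_eps aug_zeta.
by rewrite expr0n expr1n gtn_eqF ?(valP (k l))// !(mulr0, mul0r, subrr, addr0).
Qed.

Lemma relset_closed : idealr_closed relset.
Proof.
split.
- apply/asboolP; exists (fun=> 0), (fun=> 0), (fun=> 0).
  by rewrite big1// => l _; rewrite !mul0r !addr0.
- by apply/negP => /aug_relset; rewrite rmorph1.
- move=> x u v /asboolP[a [b [c ->]]] /asboolP[a' [b' [c' ->]]].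
  apply/asboolP; exists (fun l => x * a l + a' l),
    (fun l => x * b l + b' l), (fun l => x * c l + c' l).
  rewrite mulr_sumr -big_split/=; apply: eq_bigr => l _.
  by ring.
Qed.

HB.instance Definition _ := isIdealr.Build pring relset relset_closed.


Definition relideal : idealr pring := relset.

(* qring is Z[eps, zeta] modulo the ideal generated by eps_l ^ k_l,
   zeta_l ^ m_l - 1 and eps_l (zeta_l - 1). *)
Definition qring := {ideal_quot relideal}.
HB.instance Definition _ := GRing.ComNzRing.on qring.

Definition qproj : pring -> qring := (\pi_qring)%qT.
HB.instance Definition _ := GRing.RMorphism.on qproj.

Definition eps (l : 'I_n) : qring := qproj (peps l).
Definition zeta (l : 'I_n) : qring := qproj (pzeta l).

Lemma qproj_eq0 p : (qproj p == 0) = (p \in relset).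
Proof.
rewrite -(rmorph0 qproj) /qproj.
by have := Quotient.idealrBE relideal p 0; rewrite subr0 => ->.
Qed.

Definition qrepr (x : qring) : pring := repr x.

Lemma qreprK x : qproj (qrepr x) = x.
Proof. exact: reprK. Qed.

Definition theta (x : qring) : int := aug (qrepr x).

Lemma theta_qproj p : theta (qproj p) = aug p.
Proof.
apply/eqP; rewrite -subr_eq0 -[_ - _]/(aug _ - aug p) -rmorphB.
apply/eqP/aug_relset.
by rewrite -qproj_eq0 (rmorphB qproj) subr_eq0; apply/eqP/qreprK.
Qed.

Lemma theta_zmod_morphism : zmod_morphism theta.
Proof.
by move=> x y; rewrite -(qreprK x) -(qreprK y) -rmorphB !theta_qproj rmorphB.
Qed.

Lemma theta_monoid_morphism : monoid_morphism theta.
Proof.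
split=> [|x y]; first by rewrite -(rmorph1 qproj) theta_qproj rmorph1.
by rewrite -(qreprK x) -(qreprK y) -rmorphM !theta_qproj rmorphM.
Qed.

HB.instance Definition _ :=
  GRing.isZmodMorphism.Build qring int theta theta_zmod_morphism.
HB.instance Definition _ :=
  GRing.isMonoidMorphism.Build qring int theta theta_monoid_morphism.

Lemma theta_eps l : theta (eps l) = 0.
Proof. by rewrite theta_qproj aug_eps. Qed.

Lemma theta_zeta l : theta (zeta l) = 1.
Proof. by rewrite theta_qproj aug_zeta. Qed.

Lemma relset_gen (a b c : pring) (l : 'I_n) :
  a * peps l ^+ k l + b * (pzeta l ^+ m l - 1)
    + c * (peps l * (pzeta l - 1)) \in relset.
Proof.
apply/asboolP; exists (fun j => if j == l then a else 0),
  (fun j => if j == l then b else 0), (fun j => if j == l then c else 0).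
rewrite (bigD1 l)//= eqxx big1 ?addr0// => j /negPf ->.
by rewrite !mul0r !addr0.
Qed.

Lemma eps_expk l : eps l ^+ k l = 0.
Proof.
apply/eqP; rewrite -rmorphXn qproj_eq0.
by have := relset_gen 1 0 0 l; rewrite mul1r !mul0r !addr0.
Qed.

Lemma zeta_expm l : zeta l ^+ m l = 1.
Proof.
apply/eqP; rewrite -subr_eq0 -(rmorph1 qproj) -rmorphXn -rmorphB qproj_eq0.
by have := relset_gen 0 1 0 l; rewrite mul1r !mul0r add0r !addr0.
Qed.

Lemma eps_zeta l : eps l * zeta l = eps l.
Proof.
apply/eqP; rewrite -subr_eq0 -rmorphM -rmorphB qproj_eq0.
by have := relset_gen 0 0 1 l; rewrite mul1r !mul0r !add0r mulrBr mulr1.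
Qed.

Definition Sset (l : 'I_n) : set qring :=
  [set eps l ^+ j | j in [set j | (1 <= j <= k l)%N]]
  `|` [set zeta l ^+ s | s in [set s | (s < m l)%N]].

Definition Theta (z : {ffun 'I_n -> qring}) : {ffun 'I_n -> int} :=
  [ffun l => theta (z l)].

Definition indicator (A : {set 'I_n}) : {ffun 'I_n -> int} :=
  [ffun l => (l \in A)%:R].

Definition lift_family (F : {set {set 'I_n}}) : set {ffun 'I_n -> qring} :=
  [set z : {ffun 'I_n -> qring} |
    (forall l, Sset l (z l)) /\ (exists2 A, A \in F & Theta z = indicator A)].

End Ring.

Arguments eps {n} k m l.
Arguments zeta {n} k m l.
Arguments Sset {n} k m l.
Arguments lift_family {n} k m F.

Definition intersection_closed (n : nat) (F : {set {set 'I_n}}) : Prop :=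
  forall A B, A \in F -> B \in F -> A :&: B \in F.

(* With indices starting at 0, the i entries preceding z_i. *)
Definition before (A : Type) (n : nat) (i : 'I_n) (z : {ffun 'I_n -> A}) :
    {ffun 'I_i -> A} :=
  [ffun j => z (widen_ord (ltnW (ltn_ord i)) j)].

Section Probability.
Context (R : realType) (d : measure_display) (T : measurableType d).
Variable P : probability T R.

Definition pr (A : Type) (X : T -> A) (a : A) : R :=
  fine (P (X @^-1` [set a])).

(* Random variables with values in a countable set A carrying the discrete
   sigma-algebra: measurability is tested on singletons. *)
Definition discrete_rv (A : Type) (X : T -> A) : Prop :=
  forall a, measurable (X @^-1` [set a]).

(* Meant for a finite nonempty E: fset_set E is empty if E is infinite. *)
Definition uniform_on (A : choiceType) (X : T -> A) (E : set A) : Prop :=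
  discrete_rv X /\
  forall a, pr X a = if a \in E then (#|` fset_set E|)%:R^-1 else 0.

Definition independent (A B : Type) (X : T -> A) (Y : T -> B) : Prop :=
  forall a b, pr (fun w => (X w, Y w)) (a, b) = pr X a * pr Y b.

(* H(U | V) = - sum_(u, v) P(U = u, V = v) ln P(U = u | V = v), for U and V
   taking finitely many values with positive probability; the sum then has
   finite support. *)
Definition cond_entropy (A B : choiceType) (U : T -> A) (V : T -> B) : R :=
  - \sum_(p \in [set: A * B])
      pr (fun w => (U w, V w)) p
      * ln (pr (fun w => (U w, V w)) p / pr V p.2).

End Probability.

(* Main.v *)
(* Idea.  Condition on the prefixes x, y of X and Y; let q(x) be the conditional
   probability that X_i is a power of epsilon, and q the mean of q(x), so that
   q = k P(X_i = 0) < 1/2.  Given x, y, the product X_i Y_i is a zeta with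
   probability (1 - q(x))(1 - q(y)), and otherwise a mixture of the uniform law u
   on the k powers of epsilon and of the law v of epsilon^min(J+J',k), with J, J'
   uniform.  A weighted Pinsker inequality bounds below the entropy gained by
   mixing u and v, for every k >= 5, and H(v) >= ln m + 19/200.  With these two
   bounds, the conditional entropy of X_i Y_i given x, y is at least
     (1 - q(y)) h(q(x)) + (1 - q(x)) h(q(y)) + w ln k + (1 - w) ln m
     - 7/10 [(1 - 2 q(y)) q(x)(1 - q(x)) + (1 - 2 q(x)) q(y)(1 - q(y))],
   where h is the binary entropy and w = q(x)(1 - q(y)) + q(y)(1 - q(x)).  By
   independence, averaging over x and y and subtracting H(X_i | X_<i) leaves
     (1 - 2q) (q (ln k - ln m) + E[h(q(x)) - 7/5 q(x)(1 - q(x))]) > 0. *)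

From HB Require Import structures.
Require Import Defs.
From mathcomp Require Import all_boot all_order all_algebra.
From mathcomp Require Import finmap all_classical all_reals all_analysis.
From mathcomp Require Import ring lra zify.
From mathcomp Require Import -(notations) mpoly.

Set Implicit Arguments.
Unset Strict Implicit.
Unset Printing Implicit Defensive.

Import Order.TTheory GRing.Theory Num.Theory.
Import numFieldNormedType.Exports.

Local Open Scope classical_set_scope.
Local Open Scope ring_scope.

(** * Logarithms and binary entropy *)

Section LogInequalities.
Context {R : realType}.
Implicit Types (x y z t a b : R).

Lemma derive_ge0_le (f df : R -> R) a b : a <= b ->
  (forall x, a <= x <= b -> is_derive x 1 f (df x)) ->
  (forall x, a <= x <= b -> 0 <= df x) -> f a <= f b.
Proof.
move=> ab fdf df0.
have [||c cab fab] := @MVT_segment R f df a b ab.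
- by move=> x; rewrite in_itv/= => /andP[ax xb]; apply: fdf; rewrite !ltW.
- apply: derivable_within_continuous => x; rewrite in_itv/= => xab.
  by have [] := fdf _ xab.
- by rewrite -subr_ge0 fab mulr_ge0 ?subr_ge0// df0.
Qed.

Lemma derive_le0_ge (f df : R -> R) a b : a <= b ->
  (forall x, a <= x <= b -> is_derive x 1 f (df x)) ->
  (forall x, a <= x <= b -> df x <= 0) -> f b <= f a.
Proof.
move=> ab fdf df0; rewrite -lerN2.
apply: (@derive_ge0_le (fun x => - f x) (fun x => - df x)) => // x xab.
  by apply: is_deriveN; exact: fdf.
by rewrite oppr_ge0 df0.
Qed.

(** A derivative with the sign of [z - 1] puts the minimum at 1. Both logarithm bounds below are of
    this kind, with contact at 1. *)
Lemma derive_sign_ge (f df : R -> R) x : 0 < x ->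
  (forall z, 0 < z -> is_derive z 1 f ((z - 1) * df z)) ->
  (forall z, 0 < z -> 0 <= df z) -> f 1 <= f x.
Proof.
move=> x0 fdf df0; have [x1|/ltW x1] := leP 1 x.
  apply: (@derive_ge0_le f (fun z => (z - 1) * df z)) => // z /andP[z1 _].
    by apply: fdf; rewrite (lt_le_trans _ z1).
  by rewrite mulr_ge0 ?subr_ge0// df0// (lt_le_trans _ z1).
apply: (@derive_le0_ge f (fun z => (z - 1) * df z)) => // z /andP[xz z1].
  by apply: fdf; rewrite (lt_le_trans _ xz).
by rewrite mulr_le0_ge0 ?subr_le0// df0// (lt_le_trans _ xz).
Qed.

(** Taylor polynomial at 1; the difference has derivative [(z - 1) ^+ 3 / z], so the bound holds on
    both sides of 1. *)
Lemma ln_le_cubic z : 0 < z ->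
  (1 - z) + (1 - z) ^+ 2 / 2 + (1 - z) ^+ 3 / 3 <= - ln z.
Proof.
move=> z0; rewrite -subr_ge0.
pose f (z : R) := - ln z - ((1 - z) + (1 - z) ^+ 2 * 2^-1 + (1 - z) ^+ 3 * 3^-1).
suff: f 1 <= f z by rewrite {1}/f ln1 !subrr !expr0n/= !mul0r !addr0 !subr0 oppr0.
apply: (@derive_sign_ge f (fun z => (1 - z) ^+ 2 / z)) => // {z0}z z0.
  have dln := is_derive1_ln z0.
  apply: is_derive_eq; rewrite /GRing.scale/=.
  by field; rewrite gt_eqF.
by rewrite divr_ge0 ?sqr_ge0// ltW.
Qed.

(** The difference, written in partial fractions as [f], has derivative
    [(z - 1) ^+ 3 / (z ^+ 2 * (z + 2) ^+ 2)]. At [t = x / y] this is the bound behind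
    [kl_term_ge]. *)
Lemma ln_ge_pade t : 0 < t ->
  (t - 1) * (5 * t + 1) / (2 * t * (t + 2)) <= ln t.
Proof.
move=> t0.
pose f (z : R) := ln z - 5/2 + 4^-1 * z^-1 + 27 / 4 * (z + 2)^-1.
rewrite -subr_ge0 (_ : _ - _ = f t); last first.
  by rewrite /f; field; rewrite (gt_eqF t0) gt_eqF ?addr_gt0.
suff: f 1 <= f t by apply: le_trans; rewrite /f ln1 invr1 (_ : 1 + 2 = 3 :> R); lra.
apply: (@derive_sign_ge f (fun z => (z - 1) ^+ 2 / (z ^+ 2 * (z + 2) ^+ 2))) => // {t0}z z0.
  have dln := is_derive1_ln z0.
  have z_n0 : z != 0 by rewrite gt_eqF.
  have z2_n0 : z + 2 != 0 by rewrite gt_eqF// addr_gt0.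
  have dV1 : is_derive z 1 (fun z : R => z^-1) (- z ^- 2 *: 1) by exact: is_deriveV.
  have dV2 : is_derive z 1 (fun z : R => (z + 2)^-1) (- (z + 2) ^- 2 *: (1 + 0)).
    by apply: is_deriveV.
  apply: is_derive_eq; rewrite /GRing.scale/=.
  by field; rewrite z_n0 z2_n0.
by rewrite divr_ge0 ?sqr_ge0// mulr_ge0 ?sqr_ge0.
Qed.
End LogInequalities.

Section BinaryEntropy.
Context {R : realType}.
Implicit Types (x y z t a b c g : R).

Definition eta x : R := - (x * ln x).
Definition binent x := eta x + eta (1 - x).

Lemma eta0 : eta 0 = 0. Proof. by rewrite /eta mul0r oppr0. Qed.

Lemma eta_ge x : 0 <= x -> x * (1 - x) <= eta x.
Proof.
rewrite le_eqVlt => /predU1P[<-|x0]; first by rewrite eta0 mul0r.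
rewrite /eta -mulrN ler_pM2l// lerNr opprB.
by have := @le_ln1Dx R (x - 1); rewrite (_ : 1 + (x - 1) = x); [apply; lra|ring].
Qed.

Lemma etaM x y : 0 <= x -> 0 <= y -> eta (x * y) = x * eta y + y * eta x.
Proof.
rewrite le_eqVlt => /predU1P[<-|x0]; first by rewrite !mul0r eta0 mulr0 addr0.
rewrite le_eqVlt => /predU1P[<-|y0]; first by rewrite !(mulr0, mul0r) eta0 mulr0 addr0.
by rewrite /eta lnM ?posrE//; ring.
Qed.

Lemma is_derive_lnB t : t < 1 -> is_derive t 1 (fun x : R => ln (1 - x)) (- (1 - t)^-1).
Proof.
move=> t1; have p : 0 < 1 - t by rewrite subr_gt0.
have dln := is_derive1_ln p.
have dB : is_derive t 1 (fun x : R => 1 - x) (- 1 : R).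
  by apply: is_derive_eq; ring.
by rewrite -mulrN1; exact: is_derive1_comp.
Qed.

(** The derivative of [binent]. *)
Definition logodds t := ln (1 - t) - ln t.

Lemma is_derive_logodds t : 0 < t < 1 ->
  is_derive t 1 logodds (- (t * (1 - t))^-1).
Proof.
move=> /andP[t0 t1]; have dln := is_derive1_ln t0; have dlnB := is_derive_lnB t1.
have t_n0 : t != 0 by rewrite gt_eqF.
have u_n0 : 1 - t != 0 by rewrite gt_eqF// subr_gt0.
by rewrite /logodds; apply: is_derive_eq; field; rewrite t_n0 u_n0.
Qed.

Lemma logodds_half : logodds 2^-1 = 0.
Proof. by rewrite /logodds (_ : 1 - 2^-1 = 2^-1 :> R) ?subrr//; lra. Qed.

(** Tangent at 1/2: the difference vanishes there and decreases before it, because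
    [x * (1 - x) <= 1 / 4]. *)
Lemma logodds_ge t : 0 < t <= 2^-1 -> 2 * (1 - 2 * t) <= logodds t.
Proof.
move=> /andP[t0 t1].
pose f t := logodds t - 2 * (1 - 2 * t).
rewrite -subr_ge0 -[_ - _]/(f t).
apply: (@le_trans _ _ (f 2^-1)); first by rewrite /f logodds_half; lra.
apply: (@derive_le0_ge R f (fun x => - (x * (1 - x))^-1 + 4)) => // x /andP[tx xh].
  have dlo : is_derive x 1 logodds (- (x * (1 - x))^-1) by apply: is_derive_logodds; lra.
  by apply: is_derive_eq; rewrite /GRing.scale/=; ring.
rewrite addrC subr_le0 -[X in X <= _]invrK lef_pV2 ?posrE ?invr_gt0//; nra.
Qed.

(** For [0 < t < 1/2], the derivative of [- binent t - c * (t^-1 + (1 - t)^-1)] has the sign of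
    [c - psi t]. At 1/2 the division by 0 gives 0 instead of the limit 1/8. *)
Definition psi t := logodds t * (t * (1 - t)) ^+ 2 / (1 - 2 * t).

(** The derivative is nonnegative by [logodds_ge], since
    [2 * (1 - 2 * t) ^+ 2 + 2 * P t >= 1 / 2]. *)
Lemma psi_le a b : 0 < a -> a <= b -> b < 2^-1 -> psi a <= psi b.
Proof.
move=> a0 ab b1.
pose P t := t * (1 - t).
apply: (@derive_ge0_le R psi (fun t => P t * (logodds t * (2 * (1 - 2 * t) ^+ 2 + 2 * P t)
   - (1 - 2 * t)) / (1 - 2 * t) ^+ 2)) => // x /andP[ax xb].
  have z0 : 1 - 2 * x != 0 by rewrite gt_eqF//; lra.
  have dlo : is_derive x 1 logodds (- (x * (1 - x))^-1) by apply: is_derive_logodds; lra.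
  have dV : is_derive x 1 (fun x : R => (1 - 2 * x)^-1) (- (1 - 2 * x) ^- 2 *: (0 - 2 * 1)).
    by apply: is_deriveV.
  rewrite /psi; apply: is_derive_eq; rewrite /GRing.scale/= /P.
  by field; rewrite z0 gt_eqF/= ?gt_eqF//; lra.
have := @logodds_ge x; rewrite (lt_le_trans a0 ax) (le_trans xb (ltW b1)) => /(_ isT) lo.
have P0 : 0 <= P x by rewrite /P mulr_ge0//; lra.
rewrite divr_ge0 ?sqr_ge0// mulr_ge0// subr_ge0.
have zP : 2^-1 <= 2 * (1 - 2 * x) ^+ 2 + 2 * P x by rewrite /P; nra.
rewrite (le_trans _ (ler_pM _ _ lo zP))//; lra.
Qed.

(* In the variable [u = t^-1 + (1 - t)^-1] the binary entropy is convex on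
   [t <= 1/2], so the right-hand side is concave in [u] and attains its minimum at
   an endpoint; in terms of [t], this is the monotonicity of [psi]. *)
Lemma binent_endpoints c g t : 0 < g -> g <= t <= 2^-1 ->
  Num.min (- binent g - c * (g^-1 + (1 - g)^-1))
          (- binent 2^-1 - c * (2^-1^-1 + (1 - 2^-1)^-1))
  <= - binent t - c * (t^-1 + (1 - t)^-1).
Proof.
move=> g0 /andP[le_gt th].
pose f t := - binent t - c * (t^-1 + (1 - t)^-1).
rewrite -[leLHS]/(Num.min (f g) (f 2^-1)) -[leRHS]/(f t).
pose df t := - logodds t + c * (t ^- 2 - (1 - t) ^- 2).
have fdf x : 0 < x <= 2^-1 -> is_derive x 1 f (df x).
  move=> /andP[x0 xh]; have x1 : x < 1 by lra.
  have x_n0 : x != 0 by rewrite gt_eqF.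
  have y_n0 : 1 - x != 0 by rewrite gt_eqF//; lra.
  have dln := is_derive1_ln x0.
  have dlnB := is_derive_lnB x1.
  have dV1 : is_derive x 1 (fun z : R => z^-1) (- x ^- 2 *: 1) by exact: is_deriveV.
  have dV2 : is_derive x 1 (fun z : R => (1 - z)^-1) (- (1 - x) ^- 2 *: (0 - 1)).
    by apply: is_deriveV.
  rewrite /f /binent /eta; apply: is_derive_eq; rewrite /GRing.scale/= /df /logodds.
  by field; rewrite x_n0 y_n0.
have dfE x : 0 < x < 2^-1 ->
    df x = (1 - 2 * x) / (x * (1 - x)) ^+ 2 * (c - psi x).
  move=> /andP[x0 xh]; rewrite /df /psi; field.
  by rewrite !gt_eqF//; lra.
have coef x : 0 < x < 2^-1 -> 0 <= (1 - 2 * x) / (x * (1 - x)) ^+ 2.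
  by move=> /andP[x0 xh]; rewrite divr_ge0 ?sqr_ge0//; lra.
have [->|t_neq] := eqVneq t 2^-1; first by rewrite ge_min lexx orbT.
have {th t_neq}th : t < 2^-1 by rewrite lt_neqAle t_neq.
rewrite ge_min; have [cpsi|psic] := leP c (psi t).
  apply/orP; right; apply: (@derive_le0_ge R f df); first exact: ltW.
    by move=> x /andP[tx xh]; apply: fdf; lra.
  (* At 1/2 the factorization through [psi] fails, and the derivative is seen directly to be 0. *)
  move=> x /andP[tx]; rewrite le_eqVlt => /predU1P[->|xh].
    rewrite /df logodds_half (_ : 1 - 2^-1 = 2^-1 :> R); first by rewrite subrr mulr0 oppr0 addr0.
    by lra.
  rewrite dfE; last by lra.
  rewrite mulr_ge0_le0 ?coef ?subr_le0//; first by lra.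
  by rewrite (le_trans cpsi)// psi_le//; lra.
apply/orP; left; apply: (@derive_ge0_le R f df) => //.
  by move=> x /andP[gx xt]; apply: fdf; lra.
move=> x /andP[gx xt]; rewrite dfE; last by lra.
rewrite mulr_ge0 ?coef ?subr_ge0//; first by lra.
by rewrite (le_trans _ (ltW psic))// psi_le//; lra.
Qed.
End BinaryEntropy.

(** * The two-variable entropy inequality *)

Section TwoVariables.
Context {R : realType}.
Implicit Types (x y z t a b c g : R).

Lemma ln_quot a b : 0 < a -> 0 < b -> ln (a / b) = ln a - ln b.
Proof. by move=> a0 b0; rewrite ln_div ?posrE. Qed.

Lemma ln_ge_pade_mul t : 0 < t ->
  (t - 1) * (5 * t + 1) <= ln t * (2 * t * (t + 2)).
Proof.
by move=> t0; rewrite -ler_pdivrMr ?ln_ge_pade// !mulr_gt0 ?addr_gt0.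
Qed.

(** In 2 = 4/3 * 5/4 * 6/5 the factors are close to 1, where the rational bound is sharp; applied to
    the inverse factors it gives the upper bound. *)
Lemma ln2_bounds : (2771 / 4000 <= ln 2 :> R) * (ln 2 <= 1387 / 2000 :> R).
Proof.
have e2 : ln 2 = - ln (3 / 4) - ln (4 / 5) - ln (5 / 6) :> R.
  have -> : 2 = (3 / 4 * (4 / 5) * (5 / 6))^-1 :> R by field.
  by rewrite lnV ?posrE// !lnM ?posrE//; lra.
have e2' : ln 2 = ln (4 / 3) + ln (5 / 4) + ln (6 / 5) :> R.
  have -> : 2 = 4 / 3 * (5 / 4) * (6 / 5) :> R by field.
  by rewrite !lnM ?posrE.
have p := ln_ge_pade_mul.
split.
  have h1 := p (4 / 3); have h2 := p (5 / 4); have h3 := p (6 / 5).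
  lra.
have h1 := p (3 / 4); have h2 := p (4 / 5); have h3 := p (5 / 6).
lra.
Qed.

Lemma ln3_ge : 439 / 400 <= ln 3 :> R.
Proof.
have -> : ln 3 = ln 2 + ln (3 / 2) :> R.
  by rewrite -lnM ?posrE//; congr ln; lra.
have := @ln_ge_pade_mul (3 / 2); have [+ _] := ln2_bounds; lra.
Qed.

(** The numerator left in [diagonal_ineq] once logarithms are replaced by polynomials and rational
    constants. *)
Lemma diagonal_quintic_ge0 g : 0 <= g <= 2^-1 ->
  0 <= 13 / 2000 + 243 / 500 * g - (5 + 71 / 1200) * g ^+ 2 + 517 / 30 * g ^+ 3
     - 68 / 3 * g ^+ 4 + 28 / 3 * g ^+ 5.
Proof.
move=> /andP[g0 gh].
have g2 : 0 <= g ^+ 2 <= g by nra.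
have g3 : 0 <= g ^+ 3 by rewrite exprn_ge0.
(* The quintic has a small positive minimum close to [7 / 25]. *)
have cub : 0 <= 2 / 25 + g * (1347 / 200 - 436 / 25 * g + 28 / 3 * g ^+ 2) by nra.
have := mulr_ge0 (sqr_ge0 (g - 7 / 25)) cub; lra.
Qed.

(** The endpoint [t = 1/2], that is [x = y], of [two_variable_ineq]. *)
Lemma diagonal_ineq g : 0 < g <= 2^-1 ->
  0 <= binent g - ln 2 + 7 / 10 * (1 - 4 * g) * (1 - 2 * g)
       + 2 / 3 * (g * (1 - 2 * g) / (1 - g)) + 19 / 200 * g.
Proof.
move=> /andP[g0 gh]; have g1 : 0 < 1 - g by lra.
(* [ln g] is expanded at 1/3, not far from the critical value 7/25, and [ln (1 - g)] at [g = 0]. *)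
have lng : ln 3 + (1 - 3 * g) + (1 - 3 * g) ^+ 2 / 2 + (1 - 3 * g) ^+ 3 / 3 <= - ln g.
  have -> : ln g = ln (3 * g) - ln 3 by rewrite lnM ?posrE//; ring.
  by have := @ln_le_cubic R (3 * g); rewrite mulr_gt0// => /(_ isT); lra.
have lnB : g + g ^+ 2 / 2 + g ^+ 3 / 3 <= - ln (1 - g).
  by have := @ln_le_cubic R (1 - g) g1; rewrite (_ : 1 - (1 - g) = g) //; ring.
have Hq : 0 <= g <= 2^-1 by rewrite (ltW g0) gh.
have := diagonal_quintic_ge0 Hq.
have [_ ln2] := ln2_bounds; have ln3 := ln3_ge.
set q := (X in 0 <= X); move=> q0.
have e : g * (439 / 400 + (1 - 3 * g) + (1 - 3 * g) ^+ 2 / 2 + (1 - 3 * g) ^+ 3 / 3)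
   + (1 - g) * (g + g ^+ 2 / 2 + g ^+ 3 / 3) - 1387 / 2000
   + 7 / 10 * (1 - 4 * g) * (1 - 2 * g)
       + 2 / 3 * (g * (1 - 2 * g) / (1 - g)) + 19 / 200 * g = q / (1 - g).
  by rewrite /q; field; rewrite gt_eqF.
have p1 : g * (439 / 400 + (1 - 3 * g) + (1 - 3 * g) ^+ 2 / 2 + (1 - 3 * g) ^+ 3 / 3)
   <= eta g.
  by rewrite /eta -(mulrN g) ler_pM2l//; lra.
have p2 : (1 - g) * (g + g ^+ 2 / 2 + g ^+ 3 / 3) <= eta (1 - g).
  by rewrite /eta -mulrN ler_pM2l.
have : 0 <= q / (1 - g) by rewrite divr_ge0// ltW.
rewrite -e /binent; lra.
Qed.

(* After division by [x + y], the difference of the two sides is a function of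
   [g = xy / (x + y)] and [t = x / (x + y)]; for fixed [g] its minimum is at
   [t = 1/2] (the case [x = y]) or at [t = g] (the case [y = 1]). *)
Lemma two_variable_ineq x y : 0 <= x <= 1 -> 0 <= y <= 1 ->
  (1 - y) * eta x + (1 - x) * eta y
    - 7 / 10 * ((1 - 2 * y) * (x * (1 - x)) + (1 - 2 * x) * (y * (1 - y)))
    - 19 / 200 * (x * y)
  <= eta (x + y - x * y)
     + 2 / 3 * (x * y * (x * (1 - y) + y * (1 - x)) / (x + y - x * y)).
Proof.
wlog xy : x y / x <= y.
  move=> H; have [|/ltW] := leP x y; first exact: H.
  move=> yx x01 y01; have := H y x yx y01 x01.
  rewrite [y + x]addrC [y * x]mulrC [y * _ + _]addrC; lra.
move=> /andP[]; rewrite le_eqVlt => /predU1P[<- _|x0 x1] /andP[y0 y1].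
  by rewrite eta0 !(mul0r, mulr0, subr0, addr0, add0r, mulr1, mul1r); nra.
have {}y0 : 0 < y by apply: lt_le_trans xy.
set s := x + y; set c := x * y.
have s0 : 0 < s by rewrite addr_gt0.
have c0 : 0 < c by rewrite mulr_gt0.
have s_n0 : s != 0 by rewrite gt_eqF.
have c_n0 : c != 0 by rewrite gt_eqF.
pose t := x / s; pose g := c / s.
have g0 : 0 < g by rewrite divr_gt0.
have gt : g <= t by rewrite ler_pM2r ?invr_gt0// /c; nra.
have th : t <= 2^-1 by rewrite ler_pdivrMr// /s; lra.
have tE : t^-1 + (1 - t)^-1 = s / g.
  rewrite /t /g /c /s; field.
  by rewrite !gt_eqF//= addrK gt_eqF.
have cE : c = s * g by rewrite /g mulrC divfK.
have r0 : 0 < s - c by rewrite /s /c; nra.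
have r_n0 : s - c != 0 by rewrite gt_eqF.
have gh : g <= 2^-1 := le_trans gt th.
have g1_n0 : 1 - g != 0 by rewrite gt_eqF//; lra.
(* The claim divided by [s]; the terms [eta s] of [et] and [eg] below cancel. *)
have main : binent t + 7 / 10 * (1 - 2 * g) * s <=
    binent g + 7 / 10 * (1 - 2 * g) + 2 / 3 * (g * (1 - 2 * g) / (1 - g)) + 19 / 200 * g.
  (* By [tE], this coefficient turns the penalty at [t] into the term of [main] that is linear in
     [s]. *)
  have := @binent_endpoints R (7 / 10 * g * (1 - 2 * g)) g t g0.
  rewrite gt th => /(_ isT); rewrite tE.
  have -> : 7 / 10 * g * (1 - 2 * g) * (s / g) = 7 / 10 * (1 - 2 * g) * s.
    by field; rewrite gt_eqF.
  have -> : 7 / 10 * g * (1 - 2 * g) * (g^-1 + (1 - g)^-1) = 7 / 10 * (1 - 2 * g) / (1 - g).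
    by field; rewrite g1_n0 gt_eqF.
  (* First the endpoint [t = g], then [t = 1/2], where [diagonal_ineq] applies. *)
  rewrite ge_min => /orP[]H.
    suff : 7 / 10 * (1 - 2 * g) / (1 - g) <= 7 / 10 * (1 - 2 * g)
        + 2 / 3 * (g * (1 - 2 * g) / (1 - g)) + 19 / 200 * g by lra.
    rewrite -subr_ge0.
    have -> : 7 / 10 * (1 - 2 * g) + 2 / 3 * (g * (1 - 2 * g) / (1 - g)) + 19 / 200 * g
       - 7 / 10 * (1 - 2 * g) / (1 - g) =
       g * (19 / 200 * (1 - g) - 1 / 30 * (1 - 2 * g)) / (1 - g) by field.
    by rewrite divr_ge0 ?(mulr_ge0 (ltW g0))//; clear -g0 gh; lra.
  have e2 : binent 2^-1 = ln 2 :> R.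
    by rewrite /binent /eta (_ : 1 - 2^-1 = 2^-1 :> R) ?lnV ?posrE//; lra.
  have := @diagonal_ineq g; rewrite g0 (le_trans gt th) => /(_ isT).
  move: H; rewrite e2 (_ : 1 - 2^-1 = 2^-1 :> R); last by lra.
  rewrite invrK; lra.
have xE : x = s * t by rewrite /t mulrC divfK.
have yE : y = s * (1 - t) by rewrite mulrBr mulr1 -xE /s addrC addKr.
have t0 : 0 <= t by rewrite divr_ge0// ltW.
have t1 : 0 <= 1 - t by clear -th; lra.
have g1 : 0 <= 1 - g by clear -gh; lra.
have et : eta x + eta y = s * binent t + eta s.
  by rewrite {1}xE {1}yE /binent !(etaM (ltW s0))//; ring.
have eg : eta c + eta (s - c) = s * binent g + eta s.
  have -> : s - c = s * (1 - g) by rewrite {1}cE; ring.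
  by rewrite {1}cE /binent !(etaM (ltW s0)) ?(ltW g0)//; ring.
have ec : eta c = x * eta y + y * eta x by rewrite /c etaM// ltW.
have mains := ler_wpM2l (ltW s0) main.
have fr : s * (2 / 3 * (g * (1 - 2 * g) / (1 - g))) =
    2 / 3 * (c * (x * (1 - y) + y * (1 - x)) / (s - c)).
  have -> : x * (1 - y) + y * (1 - x) = s * (1 - 2 * g).
    by rewrite (_ : s * (1 - 2 * g) = s - 2 * (s * g)); [rewrite -cE /s /c|]; ring.
  have -> : s - c = s * (1 - g) by rewrite {1}cE; ring.
  rewrite cE; field.
  by rewrite g1_n0.
have pl : s * (7 / 10 * (1 - 2 * g)) - s * (7 / 10 * (1 - 2 * g) * s) =
   7 / 10 * ((1 - 2 * y) * (x * (1 - x)) + (1 - 2 * x) * (y * (1 - y))).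
  have -> : s * (7 / 10 * (1 - 2 * g)) - s * (7 / 10 * (1 - 2 * g) * s)
          = 7 / 10 * ((s - 2 * (s * g)) * (1 - s)) by ring.
  by rewrite -cE /s /c; ring.
have sg : s * (19 / 200 * g) = 19 / 200 * c by rewrite cE; ring.
move: mains; rewrite !(mulrDr s) fr sg.
move: et eg; rewrite /binent; clear -ec pl; clearbody s c t g; lra.
Qed.
End TwoVariables.

(** * Mixtures and the law of a product of powers of epsilon *)

Section WeightedPinsker.
Context {R : realType}.
Variable J : finType.
Implicit Types (p r s u v : J -> R) (M a b : R).

(* [x ln (x / y) >= x - y + 3 (x - y)^2 / (2 (x + 2 y))], with the quotient
   linearized by the free parameter [tau]. *)
Lemma kl_term_ge (x y tau : R) : 0 <= x -> 0 < y ->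
  x - y + 3 * tau * (x - y) - 3 / 2 * tau ^+ 2 * (x + 2 * y) <= x * (ln x - ln y).
Proof.
rewrite le_eqVlt => /predU1P[<-|x0] y0.
  by rewrite mul0r; have := mulr_ge0 (ltW y0) (sqr_ge0 (tau + 2^-1)); lra.
have D0 : 0 < x + 2 * y by lra.
have := @ln_ge_pade_mul R (x / y) (divr_gt0 x0 y0).
rewrite ln_quot//.
have -> : (x / y - 1) * (5 * (x / y) + 1) = (x - y) * (5 * x + y) / y ^+ 2.
  by field; rewrite gt_eqF.
have -> : (ln x - ln y) * (2 * (x / y) * (x / y + 2)) =
          2 * (x * (ln x - ln y)) * (x + 2 * y) / y ^+ 2.
  by field; rewrite gt_eqF.
rewrite ler_pM2r ?invr_gt0 ?exprn_gt0// => le1.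
rewrite -(ler_pM2r D0) -(ler_pM2l (ltr0n R 2)) [leRHS]mulrA; apply: le_trans le1.
rewrite -subr_ge0.
have -> : (x - y) * (5 * x + y) - 2 * ((x - y + 3 * tau * (x - y)
     - 3 / 2 * tau ^+ 2 * (x + 2 * y)) * (x + 2 * y)) =
  3 * (x - y - tau * (x + 2 * y)) ^+ 2 by field.
by rewrite mulr_ge0 ?sqr_ge0.
Qed.

(** Summing [kl_term_ge] with parameter [tau * s j] leaves a quadratic in [tau] to maximize. Signs
    [s j] and [M = 1] give Pinsker's inequality for probability laws. *)
Lemma weighted_pinsker p r s M : 0 < M ->
  (forall j, 0 <= p j) -> (forall j, 0 < r j) ->
  \sum_j p j = \sum_j r j ->
  \sum_j s j ^+ 2 * p j <= M -> \sum_j s j ^+ 2 * r j <= M ->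
  (\sum_j s j * (p j - r j)) ^+ 2 / (2 * M) <= \sum_j p j * (ln (p j) - ln (r j)).
Proof.
move=> M0 p0 r0 pr pM rM; set D := \sum_j s j * _.
(* The maximizer of [3 * tau * D - 9 / 2 * tau ^+ 2 * M]. *)
pose tau := D / (3 * M).
have : \sum_j (p j - r j + 3 * (tau * s j) * (p j - r j)
    - 3 / 2 * (tau * s j) ^+ 2 * (p j + 2 * r j)) <= \sum_j p j * (ln (p j) - ln (r j)).
  by apply: ler_sum => j _; exact: kl_term_ge.
apply: le_trans.
have -> : \sum_j (p j - r j + 3 * (tau * s j) * (p j - r j)
    - 3 / 2 * (tau * s j) ^+ 2 * (p j + 2 * r j)) =
    3 * tau * D - 3 / 2 * tau ^+ 2 *
      (\sum_j s j ^+ 2 * p j + 2 * \sum_j s j ^+ 2 * r j).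
  rewrite sumrB big_split/= sumrB pr subrr add0r; congr (_ - _).
    by rewrite /D mulr_sumr; apply: eq_bigr => j _; ring.
  rewrite mulrDr !mulr_sumr -big_split/=; apply: eq_bigr => j _; ring.
have MM : \sum_j s j ^+ 2 * p j + 2 * \sum_j s j ^+ 2 * r j <= 3 * M by lra.
apply: (@le_trans _ _ (3 * tau * D - 3 / 2 * tau ^+ 2 * (3 * M))).
  by rewrite le_eqVlt; apply/orP; left; apply/eqP; rewrite /tau; field; rewrite gt_eqF.
by rewrite lerD2l lerN2 ler_wpM2l// mulr_ge0 ?sqr_ge0.
Qed.

Definition entropy p := \sum_j eta (p j).

Lemma entropy_mix u v s M a b : 0 < M -> 0 <= a -> 0 <= b ->
  (forall j, 0 < u j) -> (forall j, 0 <= v j) ->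
  \sum_j u j = 1 -> \sum_j v j = 1 ->
  \sum_j s j ^+ 2 * u j <= M -> \sum_j s j ^+ 2 * v j <= M ->
  eta (a + b) + a * entropy u + b * entropy v
    + (\sum_j s j * (u j - v j)) ^+ 2 / (2 * M) * (a * b / (a + b))
  <= \sum_j eta (a * u j + b * v j).
Proof.
move=> M0 + b0 u0 v0 u1 v1 uM vM.
(* For [a = 0] the mixture may vanish at some points, whereas [weighted_pinsker] needs a positive
   second law. *)
rewrite le_eqVlt => /predU1P[<-|a0].
  rewrite add0r !mul0r mulr0 !addr0.
  under [leRHS]eq_bigr => j _ do rewrite mul0r add0r etaM//.
  by rewrite big_split/= -mulr_sumr -mulr_suml v1 mul1r addrC.
set D := \sum_j s j * _; set r := a + b.
have r0 : 0 < r by rewrite ltr_wpDr.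
have r_n0 : r != 0 by rewrite gt_eqF.
pose q j := (a * u j + b * v j) / r.
have q0 j : 0 < q j by rewrite divr_gt0// ltr_wpDr ?mulr_ge0 ?mulr_gt0.
have qE j : a * u j + b * v j = r * q j by rewrite [RHS]mulrC divfK.
have qsum : \sum_j q j = 1.
  by rewrite -mulr_suml big_split/= -!mulr_sumr u1 v1 !mulr1 divff.
have qM : \sum_j s j ^+ 2 * q j <= M.
  have -> : \sum_j s j ^+ 2 * q j =
     (a * (\sum_j s j ^+ 2 * u j) + b * (\sum_j s j ^+ 2 * v j)) / r.
    rewrite !mulr_sumr -big_split/= mulr_suml; apply: eq_bigr => j _.
    by rewrite /q; field.
  by rewrite ler_pdivrMr// /r mulrDr lerD// mulrC ler_wpM2r// ltW.
have klu : (b * D / r) ^+ 2 / (2 * M) <= \sum_j u j * (ln (u j) - ln (q j)).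
  have -> : b * D / r = \sum_j s j * (u j - q j).
    rewrite /D mulr_sumr mulr_suml; apply: eq_bigr => j _.
    by rewrite /q /r; field.
  by apply: weighted_pinsker => // [j|]; rewrite ?ltW// u1 qsum.
have klv : (- a * D / r) ^+ 2 / (2 * M) <= \sum_j v j * (ln (v j) - ln (q j)).
  have -> : - a * D / r = \sum_j s j * (v j - q j).
    rewrite /D mulr_sumr mulr_suml; apply: eq_bigr => j _.
    by rewrite /q /r; field.
  by apply: weighted_pinsker => //; rewrite v1 qsum.
have := lerD (ler_wpM2l (ltW a0) klu) (ler_wpM2l b0 klv).
have -> : a * ((b * D / r) ^+ 2 / (2 * M)) + b * ((- a * D / r) ^+ 2 / (2 * M)) =
   D ^+ 2 / (2 * M) * (a * b / r).
  by rewrite /r; field; rewrite r_n0 gt_eqF.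
have -> : a * (\sum_j u j * (ln (u j) - ln (q j))) + b * (\sum_j v j * (ln (v j) - ln (q j)))
   = (\sum_j eta (a * u j + b * v j)) - eta r - a * entropy u - b * entropy v.
  under [X in _ = X - _ - _ - _]eq_bigr => j _.
    rewrite qE etaM ?(ltW r0) ?(ltW (q0 j))//.
    rewrite (_ : r * eta (q j) = - (a * u j + b * v j) * ln (q j)); last first.
      by rewrite qE /eta; ring.
    over.
  rewrite big_split/= -mulr_suml qsum mul1r addrK.
  rewrite /entropy !mulr_sumr -!sumrB -big_split/=; apply: eq_bigr => j _.
  by rewrite /eta; ring.
by lra.
Qed.
End WeightedPinsker.

Section SaturatedLaw.
Context {R : realType}.
Variable K : nat.
Local Notation k := (K.+1%:R : R).
Local Notation z := (k^-1 : R).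

Let k_gt0 : 0 < k. Proof. by rewrite ltr0n. Qed.
Let k_neq0 : k != 0. Proof. by rewrite pnatr_eq0. Qed.
Let z_gt0 : 0 < z. Proof. by rewrite invr_gt0. Qed.

(* Law of [min (a + b + 1, K)] for independent uniform [a, b] in [{0, ..., K}],
   i.e. of the exponent of a product of two nonzero powers of epsilon, where
   the index [j] stands for epsilon^(j+1). *)
Definition satlaw (j : 'I_K.+1) : R :=
  if (j < K)%N then j%:R / k ^+ 2 else 1 / 2 + 3 / 2 * z - z ^+ 2.

(** Power sums in terms of [z], the variable of all later estimates. Cubes come from squared weights
    against [satlaw]. *)
Lemma sum_ord_cubic (a0 a1 a2 a3 : R) :
  \sum_(j < K) (a0 + a1 * (j%:R * z) + a2 * (j%:R * z) ^+ 2 + a3 * (j%:R * z) ^+ 3) =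
  k * (a0 * (1 - z) + a1 * ((1 - z) * (1 - 2 * z) / 2)
  + a2 * ((1 - z) * (1 - 2 * z) * (2 - 3 * z) / 6)
  + a3 * ((1 - z) ^+ 2 * (1 - 2 * z) ^+ 2 / 4)).
Proof.
have sum n (y : R) : \sum_(j < n) (a0 + a1 * (j%:R * y) + a2 * (j%:R * y) ^+ 2
    + a3 * (j%:R * y) ^+ 3) =
  a0 * n%:R + a1 * (n%:R * (n%:R - 1) / 2) * y
  + a2 * (n%:R * (n%:R - 1) * (2 * n%:R - 1) / 6) * y ^+ 2
  + a3 * (n%:R * (n%:R - 1) / 2) ^+ 2 * y ^+ 3.
  elim: n => [|n IH]; first by rewrite big_ord0; ring.
  by rewrite big_ord_recr/= IH -[n.+1]addn1 natrD; field.
rewrite sum (_ : K%:R = k - 1); last by rewrite -natr1 addrK.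
by field.
Qed.

Lemma satlaw_sum (f : 'I_K.+1 -> R) : \sum_j f j * satlaw j =
  z * \sum_(j < K) f (widen_ord (leqnSn K) j) * (j%:R * z)
  + f ord_max * (1 / 2 + 3 / 2 * z - z ^+ 2).
Proof.
rewrite big_ord_recr/= {2}/satlaw ltnn mulr_sumr; congr (_ + _).
by apply: eq_bigr => j _; rewrite /satlaw/= ltn_ord; field.
Qed.

Lemma satlaw_ge0 j : 0 <= satlaw j.
Proof.
rewrite /satlaw; case: ifPn => _; first by rewrite divr_ge0// sqr_ge0.
have : z <= 1 by rewrite invf_le1// ler1n.
by move: z_gt0; generalize z => y; nra.
Qed.

Lemma satlaw_sum1 : \sum_j satlaw j = 1.
Proof.
have := satlaw_sum (fun=> 1); under eq_bigr => j _ do rewrite mul1r.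
move=> ->; have := sum_ord_cubic 0 1 0 0.
under eq_bigr => j _ do rewrite add0r !mul0r !addr0.
move=> ->; rewrite !mul0r mul1r.
by field.
Qed.

(* These weights give the constant 2/3 below for every [k >= 5]; it is attained
   in the limit [k -> oo]. *)
Let weight (j : 'I_K.+1) : R := if (j < K)%N then 1 - j%:R * z else - (4 / 5).

(** In [entropy_mix] the choice [M = 3 / 4 * D ^+ 2] makes the constant [D ^+ 2 / (2 * M)] equal to
    2/3; what remains is that both second moments of the weights are at most [M]. *)
Lemma satlaw_mix (a b : R) : (4 <= K)%N -> 0 <= a -> 0 <= b ->
  eta (a + b) + a * ln k + b * entropy satlaw + 2 / 3 * (a * b / (a + b))
  <= \sum_j eta (a * z + b * satlaw j).
Proof.
move=> K4 a0 b0; have z0 := z_gt0.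
have z5 : z <= 1 / 5 by rewrite div1r lef_pV2 ?posrE// ler_nat.
(* [A] is the second moment of the weights under the uniform law without its last atom, [D] the
   difference of the two mean weights. *)
pose A : R := 1 / 3 + z / 2 + z ^+ 2 / 6 - z ^+ 3.
pose D : R := A + 4 / 5 * (1 / 2 + z / 2 - z ^+ 2).
have sq : z * (\sum_(j < K) (1 - j%:R * z) ^+ 2) = A.
  have := sum_ord_cubic 1 (- 2) 1 0.
  rewrite (eq_bigr (fun j : 'I_K => (1 - j%:R * z) ^+ 2)); last by move=> j _; ring.
  by move=> ->; rewrite /A; field.
have U : \sum_j weight j ^+ 2 * z = A + 16 / 25 * z.
  rewrite -mulr_suml mulrC big_ord_recr/= {2}/weight ltnn mulrDr; congr (_ + _); last by field.
  by rewrite -sq; congr (_ * _); apply: eq_bigr => j _; rewrite /weight/= ltn_ord.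
have V : \sum_j weight j ^+ 2 * satlaw j =
    121 / 300 + 24 / 25 * z - 217 / 300 * z ^+ 2 - z ^+ 3 + z ^+ 4.
  rewrite satlaw_sum {2}/weight ltnn.
  have := sum_ord_cubic 0 1 (- 2) 1.
  rewrite (eq_bigr (fun j : 'I_K => weight (widen_ord (leqnSn K) j) ^+ 2 * (j%:R * z))).
    by move=> ->; field.
  by move=> j _; rewrite /weight/= ltn_ord; ring.
have DE : \sum_j weight j * (z - satlaw j) = D.
  rewrite (eq_bigr (fun j => weight j * z - weight j * satlaw j)); last first.
    by move=> j _; rewrite mulrBr.
  rewrite sumrB satlaw_sum -mulr_suml big_ord_recr/= {2 4}/weight ltnn.
  rewrite /D -sq [_ * z]mulrC mulrDr.
  suff -> : \sum_(j < K) (1 - j%:R * z) ^+ 2 =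
     \sum_(j < K) weight (widen_ord (leqnSn K) j)
     - \sum_(j < K) weight (widen_ord (leqnSn K) j) * (j%:R * z) by field.
  by rewrite -sumrB; apply: eq_bigr => j _; rewrite /weight/= ltn_ord; ring.
have D0 : 0 < D by rewrite /D /A; move: z0 z5; generalize z => y; nra.
have M0 : 0 < 3 / 4 * D ^+ 2 by rewrite mulr_gt0 ?exprn_gt0.
have D2 : (11 / 15) ^+ 2 + 33 / 25 * z - 18 / 25 * z ^+ 2 <= D ^+ 2.
  rewrite /D /A; move: z0 z5; generalize z => y y0 y5.
  (* [w] comes from [D] by replacing [y ^+ 3] with its upper bound [y ^+ 2 / 5]. *)
  pose w := 11 / 15 + 9 / 10 * y - 5 / 6 * y ^+ 2.
  have w0 : 0 <= w by rewrite /w; nra.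
  have y3 : y ^+ 3 <= 1 / 5 * y ^+ 2 by rewrite exprSr mulrC ler_wpM2r ?sqr_ge0.
  have y4 : 0 <= y ^+ 4 by rewrite exprn_ge0 ?ltW.
  have y2 := sqr_ge0 y.
  apply: (@le_trans _ _ (w ^+ 2)); first by rewrite /w; lra.
  have wD : w <= 1 / 3 + y / 2 + y ^+ 2 / 6 - y ^+ 3 + 4 / 5 * (1 / 2 + y / 2 - y ^+ 2).
    by rewrite /w; lra.
  by rewrite lerXn2r ?nnegrE// (le_trans w0).
have := @entropy_mix R 'I_K.+1 (fun=> z) satlaw weight _ a b M0 a0 b0 (fun=> z0) satlaw_ge0.
rewrite satlaw_sum1 sumr_const card_ord -[z *+ _]mulr_natr mulVf// => /(_ erefl erefl).
rewrite U V DE.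
have -> : A + 16 / 25 * z <= 3 / 4 * D ^+ 2.
  apply: le_trans (ler_wpM2l _ D2); last by [].
  rewrite /A; move: z0 z5; generalize z => y y0 y5.
  have : 0 <= y ^+ 3 by rewrite exprn_ge0 ?ltW.
  have : y ^+ 2 <= 1 / 5 * y by rewrite expr2 ler_pM2r.
  by lra.
have -> : 121 / 300 + 24 / 25 * z - 217 / 300 * z ^+ 2 - z ^+ 3 + z ^+ 4 <= 3 / 4 * D ^+ 2.
  apply: le_trans (ler_wpM2l _ D2); last by [].
  move: z0 z5; generalize z => y y0 y5.
  have : y ^+ 4 <= 1 / 5 * y ^+ 3 by rewrite exprS ler_wpM2r// exprn_ge0 ?ltW.
  have : 0 <= y ^+ 3 by rewrite exprn_ge0 ?ltW.
  have := sqr_ge0 y.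
  by lra.
move=> /(_ isT isT).
have -> : @entropy R 'I_K.+1 (fun=> z) = ln k.
  rewrite /entropy /= sumr_const card_ord /eta lnV ?posrE// -[_ *+ _]mulr_natr.
  by field.
by have -> : D ^+ 2 / (2 * (3 / 4 * D ^+ 2)) = 2 / 3 by field; rewrite gt_eqF.
Qed.
End SaturatedLaw.

(** * Entropy of the saturated law *)

Section SaturatedEntropy.
Context {R : realType}.

(** [ln_le_cubic] without its last term, nonnegative here; the resulting cubic can be summed by
    [sum_ord_cubic]. *)
Lemma eta_ge_cubic (x : R) : 0 <= x <= 1 ->
  3 / 2 * x - 2 * x ^+ 2 + 1 / 2 * x ^+ 3 <= eta x.
Proof.
move=> /andP[]; rewrite le_eqVlt => /predU1P[<- _|x0 x1].
  by rewrite eta0 !expr0n/= !mulr0 subrr addr0.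
have := @ln_le_cubic R x x0.
have : 0 <= (1 - x) ^+ 3 by rewrite exprn_ge0// subr_ge0.
rewrite /eta -(mulrN x) => c3 lnx.
have lnx2 : (1 - x) + (1 - x) ^+ 2 / 2 <= - ln x by lra.
by have := ler_wpM2l (ltW x0) lnx2; lra.
Qed.

Lemma ln_sqr (x : R) : 0 < x -> ln (x ^+ 2) = 2 * ln x.
Proof. by move=> x0; rewrite lnXn// mulr_natl. Qed.

Lemma ln3_le : ln 3 <= 11 / 10 :> R.
Proof.
have -> : ln 3 = ln 2 - ln (2 / 3) :> R by rewrite ln_quot//; ring.
by have := @ln_ge_pade_mul R (2 / 3); have [_ +] := @ln2_bounds R; lra.
Qed.

(** At [k = 5] the estimate [entropy_satlaw_ge] is too weak, so the atoms 0, 1, 2, 3 and 19 over 25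
    are used exactly. *)
Lemma entropy_satlaw5 : ln 2 + 19 / 200 <= entropy (@satlaw R 4).
Proof.
rewrite /entropy !big_ord_recr big_ord0/= /satlaw/=.
have e (n : nat) (x : R) : x = n%:R / 25 -> 0 < n%:R :> R ->
    eta x = n%:R / 25 * (2 * ln 5 - ln n%:R).
  move=> -> n0; rewrite /eta ln_quot//.
  have -> : ln 25 = 2 * ln 5 :> R by rewrite -ln_sqr//; congr ln; ring.
  by ring.
rewrite (_ : 0%:R / 5 ^+ 2 = 0 :> R) ?mul0r// eta0 !add0r.
rewrite (e 1%N (1%:R / _)) ?(e 2%N (2 / _)) ?(e 3%N (3 / _)) ?(e 19%N (1 / 2 + _ - _)) ?ltr0n//; try by field.
rewrite ln1.
(* 19 and 5 are compared with 20 and 4, leaving [ln 2] and logarithms of numbers close to 1. *)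
have l19 : ln 19 = 2 * ln 2 + ln 5 + ln (19 / 20) :> R.
  by rewrite -ln_sqr// -!lnM ?posrE//; [congr ln; field|lra..].
have l5 : ln 5 = 2 * ln 2 - ln (4 / 5) :> R.
  by rewrite ln_quot// (_ : ln 4 = 2 * ln 2) ?subKr; [ring|rewrite -ln_sqr//; congr ln; ring].
have h1 := @ln_le_cubic R (4 / 5).
have h2 := @ln_le_cubic R (19 / 20).
have [_ h3] := @ln2_bounds R; have h4 := ln3_le.
rewrite l19 l5; lra.
Qed.

(** Each atom below the top is [z * t] with [t = j%:R * z], so [etaM] extracts [ln k] and
    [eta_ge_cubic] applies to [t]. The last summand bounds the top atom [c]. *)
Lemma entropy_satlaw_ge K (z := K.+1%:R^-1 : R) (c := 1 / 2 + 3 / 2 * z - z ^+ 2) :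
  (0 < K)%N ->
  (ln K.+1%:R + 3 / 2) * ((1 - z) * (1 - 2 * z) / 2)
  - 2 * ((1 - z) * (1 - 2 * z) * (2 - 3 * z) / 6)
  + 1 / 2 * ((1 - z) ^+ 2 * (1 - 2 * z) ^+ 2 / 4)
  + (3 / 2 * c - 2 * c ^+ 2 + 1 / 2 * c ^+ 3) <= entropy (@satlaw R K).
Proof.
move=> K0; have k0 : 0 < K.+1%:R :> R by rewrite ltr0n.
have z0 : 0 < z by rewrite invr_gt0.
have z1 : z <= 2^-1 by rewrite lef_pV2 ?posrE// ler_nat.
rewrite /entropy big_ord_recr/= {2}/satlaw ltnn lerD//; last first.
  by apply: eta_ge_cubic; rewrite /c; move: z0 z1; generalize z => y; nra.
have := @sum_ord_cubic R K 0 (ln K.+1%:R + 3 / 2) (- 2) (1 / 2).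
rewrite -/z; set S := \sum_(_ < K) _ => sumE.
apply: (@le_trans _ _ (z * S)); first by rewrite sumE (mulrA z) mulVf ?gt_eqF// mul1r; lra.
rewrite mulr_sumr; apply: ler_sum => j _.
rewrite /satlaw/= ltn_ord.
have -> : j%:R / K.+1%:R ^+ 2 = z * (j%:R * z) by rewrite /z; field; rewrite gt_eqF.
have t0 : 0 <= j%:R * z by rewrite mulr_ge0// ltW.
have t1 : j%:R * z <= 1.
  by rewrite ler_pdivrMr// mul1r ler_nat ltnW// ltnS ltnW.
have := @eta_ge_cubic (j%:R * z); rewrite t0 t1 => /(_ isT) /(ler_wpM2l (ltW z0)).
rewrite (etaM (ltW z0) t0) {3}/eta lnV ?posrE//.
by lra.
Qed.

(** The entropy grows like half of [ln k], and [m ^ 2 <= k] gives [ln m] at most that half. For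
    [k <= 8] one has [m <= 2] and the cases are numerical; [k >= 9] is treated uniformly. *)
Lemma entropy_satlaw_ln K (m : nat) : (4 <= K)%N -> (0 < m)%N -> (m ^ 2 <= K.+1)%N ->
  ln m%:R + 19 / 200 <= entropy (@satlaw R K).
Proof.
move=> K4 m0 mK.
have m0' : 0 < m%:R :> R by rewrite ltr0n.
have [K8|K8] := leqP 8 K; last first.
  have m2 : (m <= 2)%N by rewrite -ltnS -(ltn_sqr m 3) (leq_ltn_trans mK).
  have lnm : ln m%:R <= ln 2 :> R by rewrite ler_ln ?posrE// ler_nat.
  have [->|K_neq4] := eqVneq K 4; first by have := entropy_satlaw5; lra.
  have ln6 : 179 / 100 <= ln K.+1%:R :> R.
    have [h1 _] := @ln2_bounds R; have h2 := @ln3_ge R.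
    apply: (@le_trans _ _ (ln 6)); last by rewrite ler_ln ?posrE// ler_nat ltn_neqAle eq_sym K_neq4.
    by rewrite (_ : 6 = 2 * 3) ?lnM ?posrE//; [lra|ring].
  have [_ ln2] := @ln2_bounds R.
  apply: le_trans (entropy_satlaw_ge (ltn_trans _ K4)) => //.
  have : K \in [:: 5; 6; 7]%N by move: K4 K8 K_neq4; clear; case: K => [|[|[|[|[|[|[|[|]]]]]]]].
  by rewrite !inE => /or3P[] /eqP KE; move: ln6; rewrite KE; lra.
have lnm : 2 * ln m%:R <= ln K.+1%:R :> R.
  by rewrite -ln_sqr// -natrX ler_ln ?posrE ?ltr0n ?expn_gt0 ?m0// ler_nat.
apply: le_trans (entropy_satlaw_ge (ltn_trans _ K4)) => //.
have k0 : 0 < K.+1%:R :> R by rewrite ltr0n.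
(* [ln k / k] enters with a negative coefficient. Its upper bound comes from the tangent to [ln] at
   9 and [ln 9 <= 11 / 5]. *)
have lnk : ln K.+1%:R * K.+1%:R^-1 <= 6 / 5 * K.+1%:R^-1 + 1 / 9 :> R.
  have := @le_ln1Dx R (K.+1%:R / 9 - 1).
  rewrite addrCA subrr addr0 ln_quot// (_ : ln 9 = 2 * ln 3); last first.
    by rewrite -ln_sqr//; congr ln; ring.
  rewrite ltrBrDl subrr divr_gt0// => /(_ isT) h.
  have h3 := ln3_le.
  have : ln K.+1%:R <= 6 / 5 + K.+1%:R / 9 :> R by lra.
  move=> /(ler_wpM2r (ltW (_ : 0 < K.+1%:R^-1 :> R))) => /(_ (eqbRL (invr_gt0 _) k0)).
  by move=> /le_trans; apply; rewrite le_eqVlt; apply/orP; left; apply/eqP; field; rewrite gt_eqF.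
have z0 : 0 < K.+1%:R^-1 :> R by rewrite invr_gt0.
have z9 : K.+1%:R^-1 <= 1 / 9 :> R by rewrite div1r lef_pV2 ?posrE// ler_nat.
move: lnm lnk z0 z9; generalize (K.+1%:R^-1 : R) => z; generalize (ln K.+1%:R : R) => l.
generalize (ln m%:R : R) => lm => lml lz z0 z9.
have lzz : l * z * (3 / 2 - z) <= (6 / 5 * z + 1 / 9) * (3 / 2 - z).
  by rewrite ler_wpM2r//; lra.
have z2 : 0 <= z ^+ 2 <= 1 / 9 * z by rewrite sqr_ge0 expr2 ler_wpM2r// ltW.
have z3 : 0 <= z ^+ 3 <= 1 / 9 * z ^+ 2.
  by rewrite exprn_ge0 ?(ltW z0)//= exprS ler_wpM2r ?sqr_ge0.
have z4 : 0 <= z ^+ 4 <= 1 / 9 * z ^+ 3.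
  by rewrite exprn_ge0 ?(ltW z0)//= exprS ler_wpM2r ?exprn_ge0 ?(ltW z0).
have z5 : 0 <= z ^+ 5 <= 1 / 9 * z ^+ 4.
  by rewrite exprn_ge0 ?(ltW z0)//= exprS ler_wpM2r ?exprn_ge0 ?(ltW z0).
have z6 : 0 <= z ^+ 6 <= 1 / 9 * z ^+ 5.
  by rewrite exprn_ge0 ?(ltW z0)//= exprS ler_wpM2r ?exprn_ge0 ?(ltW z0).
by lra.
Qed.
End SaturatedEntropy.

(** * Averaging over pairs of prefixes *)

Section AveragedInequality.
Context {R : realType}.
Variables K m : nat.
Implicit Types x y : R.

(** Entropy of a letter that is a uniform power of epsilon with probability [x], and otherwise
    uniform on [m] powers of zeta. *)
Definition law_entropy x := binent x + x * ln K.+1%:R + (1 - x) * ln m%:R.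

(** Entropy of the product of two independent such letters, with parameters [x] and [y]. *)
Definition product_entropy x y :=
  \sum_(j < K.+1) eta ((x * (1 - y) + y * (1 - x)) * K.+1%:R^-1 + x * y * @satlaw R K j)
  + eta ((1 - x) * (1 - y)) + (1 - x) * (1 - y) * ln m%:R.

Hypotheses (K4 : (4 <= K)%N) (m0 : (0 < m)%N) (mK : (m ^ 2 <= K.+1)%N).

(** [satlaw_mix] treats the powers of epsilon; the surplus 19/200 of [entropy_satlaw_ln], weighted
    by [x * y], pays for the same term in [two_variable_ineq]. *)
Lemma product_entropy_ge x y : 0 <= x <= 1 -> 0 <= y <= 1 ->
  (1 - y) * binent x + (1 - x) * binent y
  + (x * (1 - y) + y * (1 - x)) * ln K.+1%:R
  + (1 - (x * (1 - y) + y * (1 - x))) * ln m%:R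
  - 7 / 10 * ((1 - 2 * y) * (x * (1 - x)) + (1 - 2 * x) * (y * (1 - y)))
  <= product_entropy x y.
Proof.
move=> /[dup] x01 /andP[x0 x1] /[dup] y01 /andP[y0 y1].
have w10 : 0 <= x * (1 - y) + y * (1 - x).
  by rewrite addr_ge0// mulr_ge0// subr_ge0.
have xy0 : 0 <= x * y by rewrite mulr_ge0.
have := satlaw_mix K4 w10 xy0.
have rE : x * (1 - y) + y * (1 - x) + x * y = x + y - x * y by ring.
rewrite rE; have := two_variable_ineq x01 y01.
rewrite /product_entropy etaM ?subr_ge0//.
have := ler_wpM2l xy0 (@entropy_satlaw_ln R K m K4 m0 mK).
rewrite /binent; set w := x * (1 - y) + y * (1 - x).
rewrite (_ : x * y * w / (x + y - x * y) = w * (x * y) / (x + y - x * y)); last by rewrite [w * _]mulrC.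
set f := w * (x * y) / _.
have -> : 1 - w = x * y + (1 - x) * (1 - y) by rewrite /w; ring.
by lra.
Qed.

Lemma averaged_entropy_lt (A : Type) (r : seq A) (p q : A -> R) :
  (forall a, 0 <= p a) -> (forall a, 0 <= q a <= 1) ->
  \sum_(a <- r) p a = 1 -> 0 < \sum_(a <- r) p a * q a < 1 / 2 ->
  \sum_(a <- r) p a * law_entropy (q a) <
  \sum_(a <- r) \sum_(b <- r) p a * p b * product_entropy (q a) (q b).
Proof.
move=> p0 q01 p1; set t := \sum_(a <- r) p a * q a => /andP[t0 th].
pose E (f : A -> R) := \sum_(a <- r) p a * f a.
have ED f g : E (fun a => f a + g a) = E f + E g.
  by rewrite /E -big_split; apply: eq_bigr => a _; rewrite mulrDr.
have EM f c : E (fun a => c * f a) = c * E f.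
  by rewrite /E mulr_sumr; apply: eq_bigr => a _; rewrite mulrCA.
have EC c : E (fun=> c) = c by rewrite /E -mulr_suml p1 mul1r.
have Ele f g : (forall a, f a <= g a) -> E f <= E g.
  by move=> fg; apply: ler_sum => a _; rewrite ler_wpM2l.
pose H := E (fun a => binent (q a)).
pose V := E (fun a => q a * (1 - q a)).
set lk := ln K.+1%:R : R; set lm := ln m%:R : R.
have V0 : 0 <= V.
  rewrite -(EC 0); apply: Ele => a; have /andP[? ?] := q01 a.
  by rewrite mulr_ge0// subr_ge0.
have HV : 2 * V <= H.
  rewrite -EM; apply: Ele => a; have /andP[a0 a1] := q01 a.
  rewrite /binent; have := eta_ge a0; have := @eta_ge R (1 - q a).
  by rewrite subr_ge0 a1 => /(_ isT); lra.
have lkm : lm < lk.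
  rewrite ltr_ln ?posrE ?ltr0n// ltr_nat.
  have [m1|m1] := ltnP 1 m; last by rewrite (leq_ltn_trans m1)// ltnS (leq_trans _ K4).
  by rewrite (leq_trans _ mK)// -mulnn ltn_Pmull.
have Elaw (f : A -> R) : E (fun a => f a + q a * lk + (1 - q a) * lm) = E f + t * lk + (1 - t) * lm.
  transitivity (E (fun a => f a + (lk - lm) * q a + lm)).
    by congr E; apply: funext => a; ring.
  by rewrite !ED !EM EC -[E q]/t; ring.
have Epair (f : A -> R) : E (fun a => E (fun b => (1 - q b) * f a + (1 - q a) * f b
    + (q a * (1 - q b) + q b * (1 - q a)) * lk
    + (1 - (q a * (1 - q b) + q b * (1 - q a))) * lm
    - 7 / 10 * ((1 - 2 * q b) * (q a * (1 - q a)) + (1 - 2 * q a) * (q b * (1 - q b))))) =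
  2 * (1 - t) * E f + 2 * t * (1 - t) * lk
    + (1 - 2 * t * (1 - t)) * lm - 7 / 5 * (1 - 2 * t) * V.
  (* The average is taken over [b], then over [a], each time regrouping into multiples of [q], [f],
     [q * (1 - q)] and a constant. *)
  transitivity (E (fun a => (1 - t) * f a
     + ((lk - lm) * (1 - 2 * t) - E f + 7 / 5 * V) * q a
     + (- (7 / 10) * (1 - 2 * t)) * (q a * (1 - q a))
     + (E f + t * (lk - lm) + lm - 7 / 10 * V))).
    congr E; apply: funext => a.
    transitivity (E (fun b => (- f a + (1 - 2 * q a) * (lk - lm)
       + 7 / 5 * (q a * (1 - q a))) * q b + (1 - q a) * f b
      + (- (7 / 10) * (1 - 2 * q a)) * (q b * (1 - q b))
      + (f a + q a * (lk - lm) + lm - 7 / 10 * (q a * (1 - q a))))).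
      by congr E; apply: funext => b; field.
    by rewrite !ED !EM !EC -[E q]/t -/V; field.
  by rewrite !ED !EM !EC -[E q]/t -/V; field.
rewrite -[ltLHS]/(E (fun a => law_entropy (q a))) Elaw -/H.
have -> : \sum_(a <- r) \sum_(b <- r) p a * p b * product_entropy (q a) (q b) =
    E (fun a => E (fun b => product_entropy (q a) (q b))).
  by apply: eq_bigr => a _; rewrite mulr_sumr; apply: eq_bigr => b _; rewrite mulrA.
apply: lt_le_trans (_ : 2 * (1 - t) * H + 2 * t * (1 - t) * lk
    + (1 - 2 * t * (1 - t)) * lm - 7 / 5 * (1 - 2 * t) * V <= _).
  rewrite -subr_gt0.
  have -> : 2 * (1 - t) * H + 2 * t * (1 - t) * lk
    + (1 - 2 * t * (1 - t)) * lm - 7 / 5 * (1 - 2 * t) * V - (H + t * lk + (1 - t) * lm)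
    = (1 - 2 * t) * (t * (lk - lm) + (H - 2 * V) + 3 / 5 * V) by field.
  rewrite mulr_gt0//; first by lra.
  rewrite ltr_pwDl ?ltr_wpDr ?subr_ge0//; last by rewrite mulr_ge0.
  by rewrite mulr_gt0 ?subr_gt0.
rewrite -Epair.
by apply: (Ele _ _) => a; apply: (Ele _ _) => b; exact: product_entropy_ge.
Qed.
End AveragedInequality.

(** * The quotient ring *)

Lemma inj_countable (T : Type) (C : countType) (f : T -> C) :
  injective f -> countable [set: T].
Proof.
move=> finj; apply/countable_injP; exists (choice.pickle \o f).
by move=> x y _ _ /(pcan_inj choice.pickleK)/finj.
Qed.

Lemma countable_ffun (T : Type) (I : finType) :
  countable [set: T] -> countable [set: {ffun I -> T}].
Proof.
move=> /countable_injP[f finj].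
pose F (g : {ffun I -> T}) : {ffun I -> nat} := [ffun i => f (g i)].
apply: (@inj_countable _ _ F).
move=> g h /ffunP gh; apply/ffunP => i.
by have := gh i; rewrite !ffunE => /finj; apply; rewrite inE.
Qed.

Section QuotientRing.
Variables (n : nat) (k m : 'I_n -> posnat).
Implicit Types (l : 'I_n).

(** A class is determined by the finite list of monomials and integer coefficients of its
    representative. Countability extends measurability from singletons to all preimages. *)
Lemma countable_qring : countable [set: qring k m].
Proof.
pose f (x : qring k m) : seq (multinom (n + n) * int) :=
  [seq (a, mcoeff a (qrepr x)) | a <- msupp (qrepr x)].
apply: (@inj_countable _ _ f).
have fE x : qrepr x = \sum_(a <- f x) a.2 *: mpolyX int a.1.
  by rewrite big_map [LHS]mpolyE.
by move=> x y fxy; rewrite -(qreprK x) -(qreprK y) !fE fxy.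
Qed.

Section Evaluation.
Variable v : 'I_(n + n) -> {poly int}.

Definition peval : pring n -> {poly int} := mmap (intmul (1 : {poly int})) v.

HB.instance Definition _ := GRing.RMorphism.on peval.

Lemma peval_eps l : peval (peps l) = v (lshift n l).
Proof. by rewrite /peval /peps mmapX mmap1U. Qed.

Lemma peval_zeta l : peval (pzeta l) = v (rshift n l).
Proof. by rewrite /peval /pzeta mmapX mmap1U. Qed.

End Evaluation.

(** Evaluation in integer polynomials maps the relations to their evaluated forms; a suitable [v]
    leaves a question in one variable. *)
Lemma qproj_eq_peval (p q : pring n) (v : 'I_(n + n) -> {poly int}) :
  qproj k m p = qproj k m q ->
  exists a b c : 'I_n -> {poly int},
   peval v p - peval v q = \sum_(l < n) (a l * v (lshift n l) ^+ k l
     + b l * (v (rshift n l) ^+ m l - 1)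
     + c l * (v (lshift n l) * (v (rshift n l) - 1))).
Proof.
move=> /eqP; rewrite -subr_eq0 -rmorphB qproj_eq0 => /asboolP[a [b [c e]]].
exists (peval v \o a), (peval v \o b), (peval v \o c).
rewrite -rmorphB e rmorph_sum; apply: eq_bigr => l _.
by rewrite !rmorphD !rmorphM !rmorphB !rmorphXn/= !rmorph1 !peval_eps !peval_zeta.
Qed.

(** With epsilon_l sent to ['X], the other epsilons to 0 and all zetas to 1, the ideal lands in the
    multiples of ['X^(k l)], which have no term of degree [j < j' <= k l]. *)
Lemma eps_inj l (j j' : nat) : (j <= k l)%N -> (j' <= k l)%N ->
  eps k m l ^+ j = eps k m l ^+ j' -> j = j'.
Proof.
wlog jj' : j j' / (j < j')%N.
  by move=> H jk jk' e; have [/H|/H|//] := ltngtP j j' => ->.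
move=> _ j'k; rewrite -!rmorphXn.
pose v (i : 'I_(n + n)) : {poly int} :=
  if fintype.split i is inl l' then 'X *+ (l' == l) else 1.
move=> /(@qproj_eq_peval _ _ v)[a [b [c]]].
rewrite !rmorphXn/= !peval_eps.
have vl l' : v (lshift n l') = 'X *+ (l' == l).
  by rewrite /v -[lshift n l']/(unsplit (inl l')) unsplitK.
have vr l' : v (rshift n l') = 1.
  by rewrite /v -[rshift n l']/(unsplit (inr l')) unsplitK.
rewrite (bigD1 l)//= big1 ?addr0; last first.
  move=> l' /negPf l'l; rewrite vl vr l'l mulr0n expr0n gtn_eqF ?(valP (k l'))//.
  by rewrite expr1n subrr !mulr0 !addr0.
rewrite vl vr eqxx mulr1n expr1n subrr !mulr0 !addr0.
move=> /(congr1 (fun p : {poly int} => p`_j)).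
rewrite coefB !coefXn eqxx [j == j']ltn_eqF// subr0 coefMXn (leq_trans jj' j'k).
by move=> /eqP; rewrite oner_eq0.
Qed.

(** With zeta_l sent to ['X], the other zetas to 1 and all epsilons to 0, the ideal lands in the
    multiples of the monic ['X^(m l) - 1]; a nonzero multiple has degree at least [m l]. *)
Lemma zeta_inj l (s s' : nat) : (s < m l)%N -> (s' < m l)%N ->
  zeta k m l ^+ s = zeta k m l ^+ s' -> s = s'.
Proof.
move=> sm s'm; rewrite -!rmorphXn.
pose v (i : 'I_(n + n)) : {poly int} :=
  if fintype.split i is inr l' then (if l' == l then 'X else 1) else 0.
move=> /(@qproj_eq_peval _ _ v)[a [b [c]]].
rewrite !rmorphXn/= !peval_zeta.
have vl l' : v (lshift n l') = 0.
  by rewrite /v -[lshift n l']/(unsplit (inl l')) unsplitK.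
have vr l' : v (rshift n l') = if l' == l then 'X else 1.
  by rewrite /v -[rshift n l']/(unsplit (inr l')) unsplitK.
rewrite (bigD1 l)//= big1 ?addr0; last first.
  move=> l' /negPf l'l; rewrite vl vr l'l expr0n gtn_eqF ?(valP (k l'))//.
  by rewrite expr1n subrr !(mulr0, mul0r) !addr0.
rewrite vl vr eqxx expr0n gtn_eqF ?(valP (k l))// !(mulr0, mul0r) add0r addr0 => e.
have b0 : b l = 0.
  apply/eqP; apply: contraT => b_neq0.
  have sz : size ('X^(m l) - 1 : {poly int}) = (m l).+1 by rewrite size_XnsubC ?(valP (m l)).
  have mon : 'X^(m l) - 1 \is @monic int by rewrite monicXnsubC ?(valP (m l)).
  have : (size ('X^s - 'X^s' : {poly int})%R <= m l)%N.
    by rewrite (leq_trans (size_polyD _ _))// size_polyN !size_polyXn geq_max sm.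
  rewrite e size_Mmonic// sz addnS/= leqNgt => /negP[].
  by rewrite -[ltnLHS]add0n ltn_add2r size_poly_gt0.
move: e; rewrite b0 mul0r => /eqP; rewrite subr_eq0 => /eqP.
by move=> /(congr1 (fun p : {poly int} => size p)); rewrite !size_polyXn => -[].
Qed.
End QuotientRing.

(** * Discrete random variables *)

Section DiscreteLaws.
Context (R : realType) (d : measure_display) (T : measurableType d).
Variable P : probability T R.

Lemma discrete_preimage_measurable (A : Type) (Z : T -> A) (Q : set A) :
  countable [set: A] -> discrete_rv Z -> measurable (Z @^-1` Q).
Proof.
move=> cA dZ.
have -> : Z @^-1` Q = \bigcup_a (if a \in Q then Z @^-1` [set a] else set0).
  apply/seteqP; split=> [w /= ZQ|w [a _]].
    by exists (Z w) => //; rewrite ifT// inE.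
  by case: ifPn => // /set_mem Qa /= ->.
by apply: countable_bigcupT_measurable => // a; case: ifPn.
Qed.

Lemma discrete_preimage_seq (A : choiceType) (Z : T -> A) (s : seq A) :
  discrete_rv Z -> uniq s ->
  (P (Z @^-1` [set` s]) = (\sum_(a <- s) pr P Z a)%:E)%E.
Proof.
move=> dZ us.
have -> : Z @^-1` [set` s] = \bigcup_(a in [set` s]) Z @^-1` [set a].
  by apply/seteqP; split=> [w /= ZQ|w [a /= aQ ->]//]; exists (Z w).
rewrite measure_fin_bigcup//; last first.
  by apply/trivIsetP => a b _ _ ab; apply/seteqP; split=> // w [/= ->] /eqP; rewrite (negPf ab).
rewrite -fsbig_seq// -sumEFin; apply: eq_bigr => a _.
by rewrite /pr fineK// fin_num_measure.
Qed.

(** [s] carries the whole mass, so up to a null set the event is a finite union of atoms;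
    countability makes the event measurable. *)
Lemma pr_comp (A : choiceType) (B : eqType) (Z : T -> A) (phi : A -> B) (s : seq A) b :
  countable [set: A] -> discrete_rv Z -> uniq s -> \sum_(a <- s) pr P Z a = 1 ->
  pr P (fun w => phi (Z w)) b = \sum_(a <- s | phi a == b) pr P Z a.
Proof.
move=> cA dZ us s1.
pose Q := phi @^-1` [set b].
have mQ := @discrete_preimage_measurable _ Z _ cA dZ.
have Zs1 : P (Z @^-1` [set` s]) = 1%E by rewrite discrete_preimage_seq// s1.
have Zc : P (~` (Z @^-1` [set` s])) = 0%E by rewrite probability_setC// Zs1 subee.
have Zc0 : P (Z @^-1` (Q `\` [set` s])) = 0%E.
  apply: (subset_measure0 (mQ _) (mQ (~` [set` s]))) => [w []//|].
  exact: Zc.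
have PE : P (Z @^-1` Q) = P (Z @^-1` [set` [seq a <- s | phi a == b]]).
  rewrite (measureDI P (mQ Q) (mQ [set` s])) -[X in (P X + _)%E]/(Z @^-1` (Q `\` [set` s])) Zc0 add0e.
  congr (P _); apply/seteqP; split=> w /=.
    by move=> [Qw sw]; rewrite mem_filter sw andbT; apply/eqP.
  by rewrite mem_filter => /andP[/eqP].
rewrite /pr -[_ @^-1` _]/(Z @^-1` Q) PE discrete_preimage_seq ?filter_uniq//=.
by rewrite big_filter.
Qed.

Lemma cond_entropy_seq (A B : choiceType) (U : T -> A) (V : T -> B)
    (su : seq A) (sv : seq B) : uniq su -> uniq sv ->
  (forall a b, pr P (fun w => (U w, V w)) (a, b) != 0 -> (a \in su) && (b \in sv)) ->
  cond_entropy P U V = - \sum_(b <- sv) \sum_(a <- su)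
    pr P (fun w => (U w, V w)) (a, b)
    * ln (pr P (fun w => (U w, V w)) (a, b) / pr P V b).
Proof.
move=> uu uv supp; congr (- _).
pose F (p : A * B) := pr P (fun w => (U w, V w)) p
    * ln (pr P (fun w => (U w, V w)) p / pr P V p.2).
transitivity (\sum_(p <- [seq (a, b) | a <- su, b <- sv]) F p); last first.
  by rewrite exchange_big/= big_allpairs_dep.
rewrite [RHS]fsbig_seq ?allpairs_uniq//; last by move=> [? ?] [? ?].
apply/esym/fsbig_widen => // -[a b] [_ /=] nab; apply/eqP.
apply: contra_notT nab; rewrite mulf_eq0 negb_or => /andP[/supp/andP[asu bsv] _].
by apply/allpairsP; exists (a, b).
Qed.
End DiscreteLaws.

(** * Conditional laws of a letter and of a product of letters *)

Section Convolution.
Variables K M : nat.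

(* [inl j] stands for epsilon^(j+1), so that [inl ord_max] is 0, and [inr s]
   for zeta^s. *)
Definition letter := ('I_K.+1 + 'I_M.+1)%type.

(** Indices are exponents minus one for epsilon, whence the successor, capped at [K]; for zeta, the
    sum in ['I_M.+1] is modulo [M.+1]. *)
Definition letter_mul (a b : letter) : letter :=
  match a, b with
  | inl j, inl j' => inl (inord (minn (j + j').+1 K))
  | inl j, inr _ => inl j
  | inr _, inl j => inl j
  | inr s, inr s' => inr (s + s')
  end.

Context {R : realType}.

Definition letter_law (x : R) (a : letter) : R :=
  if a is inl _ then x / K.+1%:R else (1 - x) / M.+1%:R.

(** For an index [i < K] each [a < i] has exactly one partner [b]. The value at the cap follows
    because both sides have total [K.+1%:R ^+ 2]. *)
Lemma sum_minn_eq (j : 'I_K.+1) :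
  \sum_(a < K.+1) \sum_(b < K.+1) (minn (a + b).+1 K == j)%:R =
  K.+1%:R ^+ 2 * @satlaw R K j.
Proof.
pose N (j : nat) : R := \sum_(a < K.+1) \sum_(b < K.+1) (minn (a + b).+1 K == j)%:R.
have NK i : (i < K)%N -> N i = i%:R.
  move=> iK.
  have inner (a : 'I_K.+1) : \sum_(b < K.+1) (minn (a + b).+1 K == i)%:R = (a < i)%N%:R :> R.
    have [ai|ia] := ltnP a i; last first.
      by apply: big1 => b _; rewrite (_ : (_ == _) = false)//; apply/eqP; lia.
    have bK : (i - a.+1 < K.+1)%N by lia.
    rewrite (bigD1 (Ordinal bK))//= big1 ?addr0; last first.
      move=> b; rewrite -val_eqE/= => bi.
      by rewrite (_ : (_ == i) = false)//; apply/eqP; move: bi => /eqP; lia.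
    by rewrite (_ : (_ == i) = true)//; apply/eqP; lia.
  have iK1 : (i <= K.+1)%N by lia.
  rewrite /N (eq_bigr _ (fun a _ => inner a)) -natr_sum -big_mkcond/=.
  by rewrite (big_ord_narrow iK1) sum1_card card_ord.
have Ntot : \sum_(i < K.+1) N i = K.+1%:R ^+ 2.
  rewrite /N exchange_big/=.
  have inner (a b : 'I_K.+1) : \sum_(i < K.+1) (minn (a + b).+1 K == i)%:R = 1 :> R.
    have mK : (minn (a + b).+1 K < K.+1)%N by lia.
    rewrite (bigD1 (Ordinal mK))//= eqxx big1 ?addr0// => i.
    by rewrite -val_eqE/= eq_sym => /negPf ->.
  rewrite (eq_bigr (fun=> K.+1%:R)) => [|a _].
    by rewrite sumr_const card_ord -[_ *+ _]mulr_natr -expr2.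
  by rewrite exchange_big/= (eq_bigr _ (fun b _ => inner a b)) sumr_const card_ord.
have small i : (i < K)%N -> forall i' : 'I_K.+1, i' = i :> nat ->
    N i = K.+1%:R ^+ 2 * @satlaw R K i'.
  move=> iK i' ii'; rewrite NK// /satlaw ii' iK.
  by field; rewrite nat1r pnatr_eq0.
have [jK|Kj] := ltnP j K; first exact: small.
have jE : j = ord_max by apply/val_inj/eqP; rewrite eqn_leq Kj/= -ltnS ltn_ord.
rewrite -[LHS]/(N j) jE.
have := congr1 ( *%R (K.+1%:R ^+ 2)) (@satlaw_sum1 R K).
rewrite mulr1 -{2}Ntot mulr_sumr !big_ord_recr/=.
have -> : \sum_(i < K) N i = \sum_(i < K) K.+1%:R ^+ 2 * @satlaw R K (widen_ord (leqnSn K) i).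
  by apply: eq_bigr => i _; exact: small.
by move=> /addrI ->.
Qed.

(** The law of the product of two independent letters. *)
Definition letter_conv (x y : R) (c : letter) : R :=
  \sum_a \sum_b (letter_mul a b == c)%:R * (letter_law x a * letter_law y b).

Lemma letter_conv_inl x y j : letter_conv x y (inl j) =
  (x * (1 - y) + y * (1 - x)) * K.+1%:R^-1 + x * y * @satlaw R K j.
Proof.
have k0 : 1 + K%:R != 0 :> R by rewrite nat1r pnatr_eq0.
have m0 : 1 + M%:R != 0 :> R by rewrite nat1r pnatr_eq0.
rewrite /letter_conv big_sumType/=.
under eq_bigr => a _ do rewrite big_sumType/=.
under [X in _ + X]eq_bigr => a _ do rewrite big_sumType/=.
rewrite !big_split/=.
have -> : \sum_(i < K.+1) \sum_(i0 < K.+1)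
     (inl (inord (minn (i + i0).+1 K)) == inl j :> letter)%:R * (x / K.+1%:R * (y / K.+1%:R)) =
   x * y * @satlaw R K j.
  have eqj (a b : 'I_K.+1) :
      (inl (inord (minn (a + b).+1 K)) == inl j :> letter) = (minn (a + b).+1 K == j).
    by rewrite (inj_eq inl_inj) -val_eqE/= inordK// ltnS geq_minr.
  transitivity ((\sum_(a < K.+1) \sum_(b < K.+1) (minn (a + b).+1 K == j)%:R)
      * (x / K.+1%:R * (y / K.+1%:R))).
    rewrite mulr_suml; apply: eq_bigr => a _; rewrite mulr_suml.
    by apply: eq_bigr => b _; rewrite eqj.
  by rewrite sum_minn_eq; field.
have -> : \sum_(i < K.+1) \sum_(i0 < M.+1)
     (inl i == inl j :> letter)%:R * (x / K.+1%:R * ((1 - y) / M.+1%:R)) =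
   x * (1 - y) / K.+1%:R.
  under eq_bigr => a _ do rewrite sumr_const card_ord.
  rewrite (bigD1 j)//= eqxx big1 ?addr0 ?mul1r; last first.
    by move=> i ij; rewrite (inj_eq inl_inj) (negPf ij) mul0r mul0rn.
  by rewrite -[_ *+ M.+1]mulr_natr; field; rewrite m0 k0.
have -> : \sum_(i < M.+1) \sum_(i0 < K.+1)
     (inl i0 == inl j :> letter)%:R * ((1 - x) / M.+1%:R * (y / K.+1%:R)) =
   y * (1 - x) / K.+1%:R.
  rewrite sumr_const card_ord (bigD1 j)//= eqxx big1 ?addr0 ?mul1r; last first.
    by move=> i ij; rewrite (inj_eq inl_inj) (negPf ij) mul0r.
  by rewrite -[_ *+ M.+1]mulr_natr; field; rewrite m0 k0.
rewrite [X in _ + (_ + X)]big1 => [|a _]; last by rewrite big1// => b _; rewrite mul0r.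
by field.
Qed.

Lemma letter_conv_inr x y s : letter_conv x y (inr s) = (1 - x) * (1 - y) / M.+1%:R.
Proof.
have m0 : 1 + M%:R != 0 :> R by rewrite nat1r pnatr_eq0.
rewrite /letter_conv big_sumType/=.
rewrite [X in X + _]big1 ?add0r => [|a _]; last first.
  by rewrite big_sumType/= !big1 ?addr0// => b _; rewrite mul0r.
rewrite (eq_bigr (fun=> (1 - x) / M.+1%:R * ((1 - y) / M.+1%:R))) => [|a _].
  by rewrite sumr_const card_ord -[_ *+ M.+1]mulr_natr; field.
rewrite big_sumType/= [X in X + _]big1 ?add0r => [|b _]; last by rewrite mul0r.
(* The zetas form a cyclic group: for each [a] only [b = s - a] contributes. *)
rewrite (bigD1 (s - a))//= [a + _]addrC subrK eqxx mul1r big1 ?addr0// => b bsa.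
rewrite (inj_eq inr_inj) (_ : _ == s = false) ?mul0r//.
by apply: contra_neqF bsa => /eqP <-; rewrite [a + b]addrC addrK.
Qed.

Lemma eta_div_sum (x : R) (n : nat) : 0 <= x ->
  \sum_(i < n.+1) eta (x / n.+1%:R) = eta x + x * ln n.+1%:R.
Proof.
move=> x0; have n0 : 0 < n.+1%:R :> R by rewrite ltr0n.
rewrite sumr_const card_ord etaM// ?invr_ge0 ?(ltW n0)// -[_ *+ n.+1]mulr_natr.
rewrite [eta _^-1]/eta lnV ?posrE//; field.
by rewrite gt_eqF.
Qed.

Lemma letter_law_entropy x : 0 <= x <= 1 ->
  \sum_a eta (letter_law x a) = law_entropy K M.+1 x.
Proof.
move=> /andP[x0 x1]; rewrite big_sumType/= !eta_div_sum ?subr_ge0//.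
by rewrite /law_entropy /binent; ring.
Qed.

Lemma letter_conv_entropy x y : 0 <= x <= 1 -> 0 <= y <= 1 ->
  \sum_c eta (letter_conv x y c) = product_entropy K M.+1 x y.
Proof.
move=> /andP[x0 x1] /andP[y0 y1]; rewrite big_sumType/=.
under eq_bigr => j _ do rewrite letter_conv_inl.
under [X in _ + X]eq_bigr => j _ do rewrite letter_conv_inr.
by rewrite eta_div_sum ?mulr_ge0 ?subr_ge0// addrA.
Qed.

End Convolution.

(** * Uniform words and their conditional laws *)

Section UniformSymmetricFamily.
Context (R : realType) (d : measure_display) (T : measurableType d).
Variable P : probability T R.
Variables (A : nzRingType) (n K M : nat) (i : 'I_n).
Variables (el : letter K M -> A) (s : seq {ffun 'I_n -> A}).

Definition update (z : {ffun 'I_n -> A}) (b : letter K M) : {ffun 'I_n -> A} :=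
  [ffun l => if l == i then el b else z l].

(** Letters of one kind have the same image under [theta], so membership in the lifted family does
    not distinguish them. *)
Definition same_kind (a b : letter K M) : bool :=
  match a, b with inl _, inl _ | inr _, inr _ => true | _, _ => false end.

Hypothesis el_inj : injective el.
Hypothesis elM : forall a b, el (letter_mul a b) = el a * el b.
Hypothesis countA : countable [set: A].
Hypothesis s_uniq : uniq s.
Hypothesis s_neq0 : s != [::].
Hypothesis s_el : forall z, z \in s -> exists a, z i = el a.
Hypothesis s_update : forall z a b,
  z \in s -> z i = el a -> same_kind a b -> update z b \in s.

Local Notation N := ((size s)%:R : R).
Local Notation bef := (before i).

Let N_gt0 : 0 < N. Proof. by rewrite ltr0n lt0n size_eq0. Qed.

(** The default is reached only when the entry at [i] is not a letter, hence never on [s]. *)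
Definition letter_at (z : {ffun 'I_n -> A}) : letter K M :=
  odflt (inl ord0) [pick a | el a == z i].

Lemma letter_atE z : z \in s -> z i = el (letter_at z).
Proof.
move=> /s_el[a za]; rewrite /letter_at; case: pickP => [b /eqP//|/(_ a)].
by rewrite za eqxx.
Qed.

Lemma before_update z b : bef (update z b) = bef z.
Proof.
apply/ffunP => j; rewrite !ffunE ifF//.
by rewrite -val_eqE/= ltn_eqF.
Qed.

Definition joint x a : R := \sum_(z <- s | (bef z == x) && (letter_at z == a)) N^-1.
Definition prefix_prob x : R := \sum_(z <- s | bef z == x) N^-1.

Lemma joint_ge0 x a : 0 <= joint x a.
Proof. by apply: sumr_ge0 => z _; rewrite invr_ge0 ltW. Qed.

Lemma prefix_prob_ge0 x : 0 <= prefix_prob x.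
Proof. by apply: sumr_ge0 => z _; rewrite invr_ge0 ltW. Qed.

Lemma sum_joint x (f : letter K M -> R) :
  \sum_(z <- s | bef z == x) f (letter_at z) * N^-1 = \sum_a f a * joint x a.
Proof.
rewrite (partition_big letter_at xpredT)//=; apply: eq_bigr => a _.
by rewrite /joint mulr_sumr; apply: eq_bigr => z /andP[_ /eqP ->].
Qed.

(* Replacing the letter [a] at [i] by [b] is injective on the words counted. *)
Lemma joint_same_kind x a b : same_kind a b -> joint x a = joint x b.
Proof.
have le a' b' : same_kind a' b' -> joint x a' <= joint x b'.
  move=> ab; rewrite /joint !big_const_seq !iter_addr_0 ler_pMn2l ?invr_gt0//.
  rewrite -!size_filter -(size_map (update^~ b')) uniq_leq_size//.
    rewrite map_inj_in_uniq ?filter_uniq// => z z'.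
    rewrite !mem_filter => /andP[/andP[_ /eqP za] zs] /andP[/andP[_ /eqP z'a] z's] zz'.
    apply/ffunP => l; have [->|li] := eqVneq l i.
      by rewrite !letter_atE// za z'a.
    by have /ffunP/(_ l) := zz'; rewrite !ffunE (negPf li).
  move=> _ /mapP[z + ->]; rewrite !mem_filter => /andP[/andP[zx /eqP za] zs].
  have us : update z b' \in s by apply: s_update ab => //; rewrite letter_atE// za.
  rewrite us before_update zx andbT/=; apply/eqP/el_inj.
  by rewrite -letter_atE// ffunE eqxx.
move=> ab; apply/eqP; rewrite eq_le le//= le//.
by case: (a) (b) ab => [?|?] [?|?].
Qed.

(* Conditional probability that the letter at i is a power of epsilon; it is 0
   for prefixes of probability 0, by the convention [x / 0 = 0]. *)
Definition eps_prob x : R := K.+1%:R * joint x (inl ord0) / prefix_prob x.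

Lemma prefix_prob_sum x :
  prefix_prob x = K.+1%:R * joint x (inl ord0) + M.+1%:R * joint x (inr ord0).
Proof.
have := sum_joint x (fun=> 1); under eq_bigr => z _ do rewrite mul1r.
rewrite -/(prefix_prob x) => ->; rewrite big_sumType/=; congr (_ + _).
  rewrite (eq_bigr (fun=> joint x (inl ord0))) => [|j _].
    by rewrite sumr_const card_ord mulr_natl.
  by rewrite mul1r; exact: joint_same_kind.
rewrite (eq_bigr (fun=> joint x (inr ord0))) => [|j _].
  by rewrite sumr_const card_ord mulr_natl.
by rewrite mul1r; exact: joint_same_kind.
Qed.

Lemma eps_prob01 x : 0 <= eps_prob x <= 1.
Proof.
have a0 : 0 <= K.+1%:R * joint x (inl ord0) by rewrite mulr_ge0 ?joint_ge0.
have b0 : 0 <= M.+1%:R * joint x (inr ord0) by rewrite mulr_ge0 ?joint_ge0.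
have := prefix_prob_ge0 x; rewrite /eps_prob le_eqVlt => /predU1P[<-|p0].
  by rewrite invr0 mulr0 lexx ler01.
by rewrite divr_ge0 ?(ltW p0)//= ler_pdivrMr// mul1r prefix_prob_sum lerDl.
Qed.

(** Letters of one kind are equally likely given the prefix, so a single number determines the
    conditional law. At a prefix of probability 0 both sides vanish. *)
Lemma jointE x a : joint x a = prefix_prob x * letter_law (eps_prob x) a.
Proof.
have a0 : 0 <= K.+1%:R * joint x (inl ord0) by rewrite mulr_ge0 ?joint_ge0.
have b0 : 0 <= M.+1%:R * joint x (inr ord0) by rewrite mulr_ge0 ?joint_ge0.
have k0 : K.+1%:R != 0 :> R by rewrite pnatr_eq0.
have m0 : M.+1%:R != 0 :> R by rewrite pnatr_eq0.
have := prefix_prob_ge0 x; rewrite le_eqVlt => /predU1P[p0|p0].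
  rewrite -p0 mul0r; move: p0; rewrite prefix_prob_sum => /esym/eqP.
  rewrite paddr_eq0// => /andP[]; rewrite !mulf_eq0 (negPf k0) (negPf m0)/=.
  by case: a => j /eqP jl /eqP jr; [rewrite -jl|rewrite -jr]; apply: joint_same_kind.
have p_neq0 : prefix_prob x != 0 by rewrite gt_eqF.
case: a => j; rewrite /letter_law/=.
  rewrite /eps_prob mulrA [prefix_prob x * _]mulrC divfK// mulrC mulKf//.
  exact: joint_same_kind.
rewrite /eps_prob mulrA mulrBr mulr1 [prefix_prob x * _]mulrC divfK//.
rewrite prefix_prob_sum addrC addKr mulrC mulKf//.
exact: joint_same_kind.
Qed.

Lemma sum_eta_scaled (I : finType) (p : R) (f : I -> R) :
  \sum_a p * f a * ln (p * f a / p) = - (p * \sum_a eta (f a)).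
Proof.
rewrite mulr_sumr -sumrN; apply: eq_bigr => a _.
have [->|p0] := eqVneq p 0; first by rewrite !mul0r oppr0.
by rewrite /eta [p * _ / p]mulrAC divff// mul1r; ring.
Qed.

Lemma countable_words : countable [set: {ffun 'I_n -> A}].
Proof. exact: countable_ffun. Qed.

Definition prefixes := undup [seq bef z | z <- s].

Lemma mem_prefixes z : z \in s -> bef z \in prefixes.
Proof. by move=> zs; rewrite mem_undup map_f. Qed.

Definition uniform_seq (X : T -> {ffun 'I_n -> A}) :=
  discrete_rv X /\ forall z, pr P X z = if z \in s then N^-1 else 0.

Section OneVariable.
Variable X : T -> {ffun 'I_n -> A}.
Hypothesis X_unif : uniform_seq X.

Lemma uniform_sum1 : \sum_(z <- s) pr P X z = 1.
Proof.
rewrite big_seq (eq_bigr (fun=> N^-1)) => [|z zs].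
  by rewrite -big_seq big_const_seq count_predT iter_addr_0 -[_ *+ _]mulr_natr mulVf ?gt_eqF.
by rewrite X_unif.2 zs.
Qed.

Lemma pr_uniform_comp (B : eqType) (phi : {ffun 'I_n -> A} -> B) b :
  pr P (fun w => phi (X w)) b = \sum_(z <- s | phi z == b) N^-1.
Proof.
rewrite (pr_comp phi b countable_words X_unif.1 s_uniq uniform_sum1).
rewrite big_seq_cond [RHS]big_seq_cond; apply: eq_bigr => z /andP[zs _].
by rewrite X_unif.2 zs.
Qed.

Lemma pr_letter_prefix a x :
  pr P (fun w => (X w i, bef (X w))) (el a, x) = joint x a.
Proof.
rewrite (@pr_uniform_comp _ (fun z => (z i, bef z))) /joint.
rewrite big_seq_cond [RHS]big_seq_cond; apply: eq_bigl => z.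
have [zs|//] := boolP (z \in s); rewrite xpair_eqE letter_atE// (inj_eq el_inj).
by rewrite /= andbC.
Qed.

Lemma pr_prefix x : pr P (fun w => bef (X w)) x = prefix_prob x.
Proof. exact: pr_uniform_comp. Qed.

Lemma sum_prefix (f : {ffun 'I_i -> A} -> R) :
  \sum_(z <- s) f (bef z) * N^-1 = \sum_(x <- prefixes) prefix_prob x * f x.
Proof.
under [RHS]eq_bigr => x _ do rewrite /prefix_prob mulr_suml big_mkcond/=.
rewrite exchange_big/= big_seq [RHS]big_seq; apply: eq_bigr => z zs.
rewrite (bigD1_seq (bef z)) ?undup_uniq ?mem_prefixes//= eqxx big1 ?addr0; last first.
  by move=> x; rewrite eq_sym => /negPf ->.
by rewrite mulrC.
Qed.

Lemma sum_prefix_prob : \sum_(x <- prefixes) prefix_prob x = 1.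
Proof.
under eq_bigr => x _ do rewrite -[prefix_prob x]mulr1.
rewrite -(sum_prefix (fun=> 1)) -[RHS]uniform_sum1 big_seq [RHS]big_seq.
by apply: eq_bigr => z zs; rewrite X_unif.2 zs mul1r.
Qed.

(** [inl ord_max] stands for 0, one of [K.+1] equally likely powers of epsilon; this turns the
    hypothesis on the probability of 0 into one on the mean of [eps_prob]. *)
Lemma sum_prefix_eps_prob :
  \sum_(x <- prefixes) prefix_prob x * eps_prob x =
  K.+1%:R * pr P (fun w => X w i) (el (inl ord_max)).
Proof.
rewrite (@pr_uniform_comp _ (fun z => z i)).
transitivity (K.+1%:R * \sum_(x <- prefixes) joint x (inl ord_max)).
  rewrite mulr_sumr; apply: eq_bigr => x _; rewrite jointE/=.
  by field; rewrite nat1r pnatr_eq0.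
congr (_ * _).
under eq_bigr => x _ do rewrite /joint big_mkcondr/= big_mkcond/=.
rewrite exchange_big/= [RHS]big_mkcond/= big_seq [RHS]big_seq; apply: eq_bigr => z zs.
rewrite (bigD1_seq (bef z)) ?undup_uniq ?mem_prefixes//= eqxx big1 ?addr0; last first.
  by move=> x; rewrite eq_sym => /negPf ->.
by rewrite letter_atE// (inj_eq el_inj).
Qed.

Lemma cond_entropy_letter :
  cond_entropy P (fun w => X w i) (fun w => bef (X w)) =
  \sum_(x <- prefixes) prefix_prob x * law_entropy K M.+1 (eps_prob x).
Proof.
rewrite (@cond_entropy_seq _ _ _ _ _ _ _ _ (map el (enum {: letter K M})) prefixes).
- rewrite -sumrN; apply: eq_bigr => x _; rewrite big_map big_enum/=.
  rewrite pr_prefix -letter_law_entropy ?eps_prob01//.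
  under eq_bigr => a _ do rewrite pr_letter_prefix jointE.
  by rewrite sum_eta_scaled opprK.
- by rewrite map_inj_uniq// enum_uniq.
- exact: undup_uniq.
- move=> a x; rewrite (@pr_uniform_comp _ (fun z => (z i, bef z))) => h.
  have /hasP[z zs] : has (fun z : {ffun 'I_n -> A} => (z i, bef z) == (a, x)) s.
    apply: contraR h => /hasPn h; rewrite big_seq_cond big1// => z /andP[zs].
    by rewrite (negPf (h z zs)).
  rewrite xpair_eqE => /andP[/eqP <- /eqP <-]; rewrite mem_prefixes// andbT.
  by rewrite letter_atE// map_f// mem_enum.
Qed.
End OneVariable.

Section TwoVariables.
Variables X Y : T -> {ffun 'I_n -> A}.
Hypothesis X_unif : uniform_seq X.
Hypothesis Y_unif : uniform_seq Y.
Hypothesis XY_indep : independent P X Y.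

Lemma pr_pair_comp (B : eqType) (phi : {ffun 'I_n -> A} -> {ffun 'I_n -> A} -> B) b :
  pr P (fun w => phi (X w) (Y w)) b =
  \sum_(z <- s) \sum_(z' <- s) (phi z z' == b)%:R * N^-1 * N^-1.
Proof.
pose Z w := (X w, Y w).
have cZ : countable [set: {ffun 'I_n -> A} * {ffun 'I_n -> A}].
  have /countable_injP[f f_inj] := countable_words.
  apply: (@inj_countable _ (nat * nat)%type (fun p => (f p.1, f p.2))).
  have {}f_inj : injective f by move=> u v; apply: f_inj; rewrite inE.
  by move=> [p p'] [r r'] [] /f_inj -> /f_inj ->.
have dZ : discrete_rv Z.
  move=> [a b'].
  have -> : Z @^-1` [set (a, b')] = X @^-1` [set a] `&` Y @^-1` [set b'].
    by apply/seteqP; split=> w /=; rewrite /Z => -[-> ->].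
  by apply: measurableI; [exact: X_unif.1|exact: Y_unif.1].
have uZ : uniq [seq (z, z') | z <- s, z' <- s].
  by rewrite allpairs_uniq// => -[? ?] [? ?].
have sZ : \sum_(p <- [seq (z, z') | z <- s, z' <- s]) pr P Z p = 1.
  rewrite big_allpairs_dep/= -(uniform_sum1 X_unif); apply: eq_bigr => z _.
  under eq_bigr => z' _ do rewrite XY_indep.
  by rewrite -mulr_sumr uniform_sum1 ?mulr1.
rewrite (pr_comp (fun p => phi p.1 p.2) b cZ dZ uZ sZ) big_mkcond/= big_allpairs_dep/=.
rewrite big_seq [RHS]big_seq; apply: eq_bigr => z zs.
rewrite big_seq [RHS]big_seq; apply: eq_bigr => z' z's.
rewrite [pr P Z _]XY_indep X_unif.2 Y_unif.2 zs z's.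
by case: eqP; rewrite ?(mul1r, mul0r).
Qed.

Lemma pr_prefix_pair x y :
  pr P (fun w => (bef (X w), bef (Y w))) (x, y) = prefix_prob x * prefix_prob y.
Proof.
rewrite (@pr_pair_comp _ (fun z z' => (bef z, bef z'))).
rewrite /prefix_prob [X in _ = X * _]big_mkcond [X in _ = _ * X]big_mkcond/=.
rewrite mulr_suml; apply: eq_bigr => z _; rewrite mulr_sumr; apply: eq_bigr => z' _.
by rewrite xpair_eqE; do 2!case: eqP => _; rewrite ?(mul1r, mul0r, mulr0).
Qed.

(** Given both prefixes the letters remain independent, and [elM] carries their product in [A] over
    to [letter_mul]. *)
Lemma pr_product_prefix c x y :
  pr P (fun w => (X w i * Y w i, (bef (X w), bef (Y w)))) (el c, (x, y)) =
  prefix_prob x * prefix_prob y * letter_conv (eps_prob x) (eps_prob y) c.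
Proof.
rewrite (@pr_pair_comp _ (fun z z' => (z i * z' i, (bef z, bef z')))).
transitivity (\sum_(z <- s | bef z == x)
    (\sum_(z' <- s | bef z' == y)
      (letter_mul (letter_at z) (letter_at z') == c)%:R * N^-1) * N^-1).
  rewrite [RHS]big_mkcond/= big_seq [RHS]big_seq; apply: eq_bigr => z zs.
  case: ifPn => zx; last first.
    by apply: big1 => z' _; rewrite !xpair_eqE (negPf zx) andbF !mul0r.
  rewrite mulr_suml [RHS]big_mkcond/= big_seq [RHS]big_seq; apply: eq_bigr => z' z's.
  rewrite !xpair_eqE zx !letter_atE// -elM (inj_eq el_inj)/=.
  by case: (bef z' == y); rewrite ?andbT// andbF !mul0r.
rewrite (@sum_joint x (fun a => \sum_(z' <- s | bef z' == y)
      (letter_mul a (letter_at z') == c)%:R * N^-1)).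
rewrite /letter_conv mulr_sumr; apply: eq_bigr => a _.
rewrite (@sum_joint y (fun b => (letter_mul a b == c)%:R)) mulr_suml mulr_sumr.
by apply: eq_bigr => b _; rewrite !jointE; ring.
Qed.

Lemma cond_entropy_product :
  cond_entropy P (fun w => X w i * Y w i) (fun w => (bef (X w), bef (Y w))) =
  \sum_(x <- prefixes) \sum_(y <- prefixes)
    prefix_prob x * prefix_prob y * product_entropy K M.+1 (eps_prob x) (eps_prob y).
Proof.
rewrite (@cond_entropy_seq _ _ _ _ _ _ _ _ (map el (enum {: letter K M}))
  [seq (x, y) | x <- prefixes, y <- prefixes]).
- rewrite -sumrN big_allpairs_dep/=; apply: eq_bigr => x _; apply: eq_bigr => y _.
  rewrite big_map big_enum/=.
  rewrite pr_prefix_pair -letter_conv_entropy ?eps_prob01//.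
  under eq_bigr => a _ do rewrite pr_product_prefix.
  by rewrite sum_eta_scaled opprK.
- by rewrite map_inj_uniq// enum_uniq.
- by rewrite allpairs_uniq ?undup_uniq// => -[? ?] [? ?].
- move=> a [x y]; rewrite (@pr_pair_comp _ (fun z z' => (z i * z' i, (bef z, bef z')))) => h.
  have /hasP[z zs /hasP[z' z's]] : has (fun z : {ffun 'I_n -> A} =>
      has (fun z' : {ffun 'I_n -> A} => (z i * z' i, (bef z, bef z')) == (a, (x, y))) s) s.
    apply: contraR h => /hasPn h; rewrite big_seq big1// => z zs.
    rewrite big_seq big1// => z' z's.
    have /hasPn/(_ _ z's)/negPf -> := h z zs.
    by rewrite !mul0r.
  rewrite !xpair_eqE => /and3P[/eqP <- /eqP <- /eqP <-].
  rewrite !letter_atE// -elM map_f ?mem_enum//=.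
  by apply/allpairsP; exists (bef z, bef z'); rewrite !mem_prefixes.
Qed.

Lemma cond_entropy_product_gt : (4 <= K)%N -> (M.+1 ^ 2 <= K.+1)%N ->
  0 < K.+1%:R * pr P (fun w => X w i) (el (inl ord_max)) < 1 / 2 ->
  cond_entropy P (fun w => X w i) (fun w => bef (X w)) <
  cond_entropy P (fun w => X w i * Y w i) (fun w => (bef (X w), bef (Y w))).
Proof.
move=> K4 MK t01; rewrite (cond_entropy_letter X_unif) cond_entropy_product.
apply: averaged_entropy_lt => //.
- exact: prefix_prob_ge0.
- exact: eps_prob01.
- exact: sum_prefix_prob X_unif.
- by rewrite (sum_prefix_eps_prob X_unif).
Qed.

End TwoVariables.
End UniformSymmetricFamily.

(** * Letters as elements of the quotient ring *)

Section Letters.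
Variables (n : nat) (k m : 'I_n -> posnat) (i : 'I_n).
Local Notation K := (nat_of_posnat (k i)).-1.
Local Notation M := (nat_of_posnat (m i)).-1.

Let kE : nat_of_posnat (k i) = K.+1. Proof. by rewrite prednK// (valP (k i)). Qed.
Let mE : nat_of_posnat (m i) = M.+1. Proof. by rewrite prednK// (valP (m i)). Qed.

Definition letter_elt (a : letter K M) : qring k m :=
  match a with inl j => eps k m i ^+ j.+1 | inr s => zeta k m i ^+ s end.

Lemma eps_ge_k e : (K < e)%N -> eps k m i ^+ e = 0.
Proof. by move=> Ke; rewrite -(subnK Ke) exprD -kE eps_expk mulr0. Qed.

Lemma eps_zetaX j s : eps k m i ^+ j.+1 * zeta k m i ^+ s = eps k m i ^+ j.+1.
Proof.
elim: s => [|s IH]; first by rewrite mulr1.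
by rewrite [zeta k m i ^+ s.+1]exprSr mulrA IH exprSr -mulrA eps_zeta.
Qed.

Lemma letter_eltM a b : letter_elt (letter_mul a b) = letter_elt a * letter_elt b.
Proof.
case: a b => [j|s] [j'|s']; rewrite /letter_elt/=.
- rewrite inordK ?ltnS ?geq_minr// -exprD.
  have [jK|Kj] := leqP (j + j').+1 K.
    by rewrite -addSnnS.
  by rewrite !eps_ge_k//; lia.
- by rewrite eps_zetaX.
- by rewrite mulrC eps_zetaX.
- by rewrite -exprD expr_mod// -mE zeta_expm.
Qed.

(** [theta] separates powers of epsilon from powers of zeta; within a kind, [eps_inj] and [zeta_inj]
    apply. *)
Lemma letter_elt_inj : injective letter_elt.
Proof.
have th (j : 'I_K.+1) (s : 'I_M.+1) : eps k m i ^+ j.+1 <> zeta k m i ^+ s.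
  move=> /(congr1 (@theta n k m)); rewrite !rmorphXn/= theta_eps theta_zeta.
  by rewrite expr0n expr1n/= => /eqP; rewrite eq_sym oner_eq0.
have jk (j : 'I_K.+1) : (j < k i)%N by rewrite [ltnRHS]kE.
have sm (s : 'I_M.+1) : (s < m i)%N by rewrite [ltnRHS]mE.
move=> [j|s] [j'|s'] /=.
- by move=> /(eps_inj (jk j) (jk j')) [/val_inj ->].
- by move=> /th.
- by move=> /esym/th.
- by move=> /(zeta_inj (sm s) (sm s'))/val_inj ->.
Qed.

Lemma Sset_letter u : Sset k m i u -> exists a, u = letter_elt a.
Proof.
case=> -[e /= eb <-].
  have eK : (e.-1 < K.+1)%N by rewrite -kE; lia.
  by exists (inl (Ordinal eK)); rewrite /= prednK//; lia.
have eM : (e < M.+1)%N by rewrite -mE.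
by exists (inr (Ordinal eM)).
Qed.

Lemma letter_Sset a : Sset k m i (letter_elt a).
Proof.
case: a => [j|s]; [left; exists j.+1|right; exists s] => //=.
  by rewrite [leqRHS]kE.
by rewrite [ltnRHS]mE.
Qed.

Lemma theta_letter a b : same_kind a b ->
  theta (letter_elt a) = theta (letter_elt b).
Proof.
case: a b => [j|s] [j'|s'] // _; rewrite /= !rmorphXn/= ?theta_eps ?theta_zeta.
  by rewrite !expr0n.
by rewrite !expr1n.
Qed.
End Letters.

(** * The lifted family *)

Section LiftFamily.
Variables (n : nat) (k m : 'I_n -> posnat) (F : {set {set 'I_n}}).

Lemma finite_Sset l : finite_set (Sset k m l).
Proof.
rewrite finite_setU; split; apply: finite_image.
  by apply: (@sub_finite_set _ _ `I_(k l).+1) => // j /=; lia.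
exact: finite_II.
Qed.

Lemma finite_lift_family : finite_set (lift_family k m F).
Proof.
pose V := fset_set (\bigcup_(l in [set: 'I_n]) Sset k m l).
have VE l u : Sset k m l u -> u \in V.
  move=> Su; rewrite /V in_fset_set ?inE; first by exists l.
  by apply: bigcup_finite => // l' _; exact: finite_Sset.
pose f (g : {ffun 'I_n -> V}) : {ffun 'I_n -> qring k m} := [ffun l => val (g l)].
apply: (@sub_finite_set _ _ (f @` setT)); last exact: finite_image.
move=> z [zS _]; exists [ffun l => [` VE l _ (zS l)]%fset] => //.
by apply/ffunP => l; rewrite !ffunE.
Qed.

Lemma lift_family_neq0 : (0 < #|F|)%N -> lift_family k m F !=set0.
Proof.
move=> /card_gt0P[A AF].
(* The indicator vector of [A]: 1 is the zeroth power of zeta, and 0 is the [k l]-th power of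
   epsilon. *)
exists [ffun l => if l \in A then 1 else eps k m l ^+ k l]; split.
  move=> l; rewrite ffunE; case: ifPn => _.
    by right; exists 0%N; rewrite ?expr0//= (valP (m l)).
  by left; exists (k l : nat) => //=; rewrite leqnn andbT (valP (k l)).
exists A => //; apply/ffunP => l; rewrite !ffunE; case: ifPn => _.
  by rewrite rmorph1.
by rewrite eps_expk rmorph0.
Qed.

Lemma update_lift_family (i : 'I_n) z a b : lift_family k m F z ->
  z i = letter_elt a -> same_kind a b ->
  lift_family k m F (update i (@letter_elt n k m i) z b).
Proof.
move=> [zS [A AF zA]] za ab; split.
  move=> l; rewrite ffunE; case: eqP => [->|_]; [exact: letter_Sset|exact: zS].
exists A => //; rewrite -zA; apply/ffunP => l; rewrite !ffunE.
by case: eqP => // ->; rewrite za (theta_letter ab).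
Qed.
End LiftFamily.

Theorem corollary1p7 (R : realType) (n : nat) (k m : 'I_n -> posnat)
    (F : {set {set 'I_n}})
    (d : measure_display) (T : measurableType d) (P : probability T R)
    (X Y : T -> {ffun 'I_n -> qring k m}) (i : 'I_n) :
  (1 <= n)%N ->
  intersection_closed F ->
  (2 <= #|F|)%N ->
  uniform_on P X (lift_family k m F) ->
  uniform_on P Y (lift_family k m F) ->
  independent P X Y ->
  (5 <= k i)%N ->
  (1 <= m i)%N ->
  (m i)%:R <= Num.sqrt ((k i)%:R : R) ->
  0 < (k i)%:R * pr P (fun w => X w i) 0 ->
  (k i)%:R * pr P (fun w => X w i) 0 < 1 / 2 ->
  cond_entropy P (fun w => X w i * Y w i)
    (fun w => (before i (X w), before i (Y w)))
  > cond_entropy P (fun w => X w i) (fun w => before i (X w)).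
Proof.
move=> _ _ F2 Xu Yu XY k5 m1 mk t0 th.
pose E := lift_family k m F.
have Efin : finite_set E := finite_lift_family k m F.
pose s : seq {ffun 'I_n -> qring k m} := fset_set E.
have sE z : (z \in s) = (z \in E) by rewrite /s in_fset_set.
have s_unif (Z : T -> {ffun 'I_n -> qring k m}) : uniform_on P Z E -> uniform_seq P s Z.
  by move=> [dZ ZE]; split=> // z; rewrite ZE sE.
have kE : nat_of_posnat (k i) = (k i).-1.+1 by rewrite prednK// (valP (k i)).
have mE : nat_of_posnat (m i) = (m i).-1.+1 by rewrite prednK// (valP (m i)).
(* The last epsilon letter has exponent [k i], hence is 0: the event in the two hypotheses on
   [X w i]. *)
have el0 : @letter_elt n k m i (inl ord_max) = 0 by rewrite /= -kE eps_expk.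
apply: (@cond_entropy_product_gt R d T P _ n (k i).-1 (m i).-1 i
  (@letter_elt n k m i) s).
- exact: letter_elt_inj.
- exact: letter_eltM.
- exact: countable_qring.
- exact: fset_uniq.
- have [z zE] := lift_family_neq0 k m (ltnW F2).
  by apply/eqP => s0; have := sE z; rewrite s0 [RHS]mem_set.
- by move=> z; rewrite sE => /set_mem[zS _]; exact: Sset_letter.
- move=> z a b; rewrite !sE => /set_mem zE za ab; apply/mem_set.
  exact: update_lift_family zE za ab.
- exact: s_unif.
- exact: s_unif.
- exact: XY.
- by rewrite -ltnS -kE.
(* Squaring the bound on [m i] removes the square root. *)
- rewrite -kE -mE -(ler_nat R) natrX.
  by rewrite -[leRHS]sqr_sqrtr ?ler0n// lerXn2r ?nnegrE ?sqrtr_ge0.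
- by rewrite el0 -kE t0.
Qed.
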